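(* Let $d\ge1$ and let $\alpha=(\alpha_1,\dots,\alpha_d)\in\mathbb{R}^d$ be such that $1,\alpha_1,\dots,\alpha_d$ are linearly independent over $\mathbb{Q}$ and span a real algebraic number field of degree $d+1$ over $\mathbb{Q}$. Define $N_1=1$ and, for $i\ge2$, let $N_i$ be the smallest integer $N>N_{i-1}$ with $\langle N\alpha\rangle<\langle N_{i-1}\alpha\rangle$; let $z^{(i)}_j$ be the nearest integer to $N_i\alpha_j$, $j=1,\dots,d$. Then there is a constant $C$, independent of $i$, such that for all $i\ge 2$ \[ J(P_{N_i,z^{(i)}})\le \frac{C}{N_i^{1/d}}. \]
   Context: For $x\in\mathbb{R}^d$, $\langle x\rangle=\max_{1\le j\le d}\min_{k\in\mathbb{Z}}|x_j-k|$. For $N\in\mathbb{N}$ and $z\in\mathbb{Z}^d$ with $\gcd(N,z_1,\dots,z_d)=1$, the rank-1 lattice point set is $P_{N,z}=\{(\{nz_1/N\},\dots,\{nz_d/N\}) : n=0,\dots,N-1\}$, $\{x\}=x-\lfloor x\rfloor$. For an $N$-point set $P\subset[0,1)^d$, the isotropic discrepancy is $J(P)=\sup_{C\in\mathcal{C}}\left|\frac{|P\cap C|}{N}-\operatorname{vol}(C)\right|$, where $\mathcal{C}$ is the family of all convex subsets of $[0,1)^d$. *)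

(* Defs.v *)
From HB Require Import structures.
From mathcomp Require Import all_boot all_order all_algebra.
From mathcomp Require Import all_classical all_reals all_analysis.
Set Implicit Arguments. Unset Strict Implicit. Unset Printing Implicit Defensive.
Import Order.TTheory GRing.Theory Num.Theory.
Local Open Scope classical_set_scope.
Local Open Scope ring_scope.

Section Defs.
Variable R : realType.

Definition dist_int (x : R) : R :=
  Num.min (x - (Num.floor x)%:~R) ((Num.floor x)%:~R + 1 - x).

Definition bracket (d : nat) (x : 'rV[R]_d) : R :=
  \big[Num.max/0]_(j < d) dist_int (x 0 j).

Definition frac (x : R) : R := x - (Num.floor x)%:~R.

(* nearest integer (ties cannot occur in the theorem since N alpha_j is irrational) *)
Definition nearest_int (x : R) : int := Num.floor (x + 2^-1).

Definition lattice_pt (d N : nat) (z : 'I_d -> int) (n : nat) : 'rV[R]_d :=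
  \row_(j < d) frac ((n%:R * (z j)%:~R) / N%:R).

Definition lattice_count (d N : nat) (z : 'I_d -> int) (C : set 'rV[R]_d) : nat :=
  #|[set n : 'I_N | lattice_pt N z n \in C]|.

Definition unit_cube (d : nat) : set 'rV[R]_d :=
  [set x | forall j, 0 <= x 0 j < 1].

Definition box (d : nat) (a b : 'rV[R]_d) : set 'rV[R]_d :=
  [set x | forall j, a 0 j <= x 0 j <= b 0 j].
Definition box_vol (d : nat) (a b : 'rV[R]_d) : R :=
  \prod_(j < d) (b 0 j - a 0 j).

Definition vol (d : nat) (A : set 'rV[R]_d) : \bar R :=
  ereal_inf [set s | exists (a b : nat -> 'rV[R]_d),
              [/\ forall k j, a k 0 j <= b k 0 j,
                  A `<=` \bigcup_k box (a k) (b k) &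
                  s = (\sum_(0 <= k <oo) (box_vol (a k) (b k))%:E)%E]].

Definition isotropic_discrepancy (d N : nat) (z : 'I_d -> int) : \bar R :=
  ereal_sup [set `| ((lattice_count N z C)%:R / N%:R)%:E - vol C |%E
            | C in [set C : set 'rV[R]_d |
                    C `<=` @unit_cube d /\ convex_set (C : set (convex_lmodType _))]].

Definition qspan (d : nat) (alpha : 'rV[R]_d) : set R :=
  [set x | exists (c : rat) (q : 'I_d -> rat),
           x = ratr c + \sum_(j < d) ratr (q j) * alpha 0 j].

Definition Q_lin_indep (d : nat) (alpha : 'rV[R]_d) : Prop :=
  forall (c : rat) (q : 'I_d -> rat),
    ratr c + \sum_(j < d) ratr (q j) * alpha 0 j = 0 ->
    c = 0 /\ forall j, q j = 0.

Definition qspan_is_field (d : nat) (alpha : 'rV[R]_d) : Prop :=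
  (forall x y, qspan alpha x -> qspan alpha y -> qspan alpha (x * y)) /\
  (forall x, qspan alpha x -> x != 0 -> qspan alpha x^-1).

Definition best_approx_seq (d : nat) (alpha : 'rV[R]_d) (N : nat -> nat) : Prop :=
  N 1%N = 1%N /\
  forall i, (2 <= i)%N ->
    [/\ (N i.-1 < N i)%N,
        bracket ((N i)%:R *: alpha) < bracket ((N i.-1)%:R *: alpha) &
        forall M, (N i.-1 < M)%N -> (M < N i)%N ->
          ~ (bracket (M%:R *: alpha) < bracket ((N i.-1)%:R *: alpha))].

End Defs.

(* Main.v *)
Require Import Defs.
From HB Require Import structures.
From mathcomp Require Import all_boot all_order all_algebra.
From mathcomp Require Import fingroup perm.
From mathcomp Require Import all_classical all_reals all_analysis.
From mathcomp Require Import ring lra zify.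
Import Order.TTheory GRing.Theory Num.Theory.
Import numFieldNormedType.Exports.
Set Implicit Arguments. Unset Strict Implicit. Unset Printing Implicit Defensive.
Local Open Scope classical_set_scope.
Local Open Scope ring_scope.
Local Notation frac := Defs.frac.

(** The proof compares the lattice [L] spanned by [z / N] and the integer
    vectors with a very fine cubical grid.

    Multiplying a vector [w = n (1, alpha) + e], with [w] integral, by integer
    matrices that have [(1, alpha)] as a common eigenvector and represent the
    multiplication by [alpha_i] in the field gives [d + 1] integral vectors whose
    determinant is nonzero and is [O(n |e|^d)]; hence [alpha] is badly
    approximable, [<n alpha> >= c n^(-1/d)].  Since [N = N_i] is a best
    approximation and [|z / N - alpha| <= <N alpha> / N], the points of [L] in the
    unit cube are at mutual distance [>= lam], where [lam] is of order [N^(-1/d)].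

    There are [N] such points, so a pigeonhole argument shows that the vectors of
    [L] of length [O(lam)] do not lie in a hyperplane; rounding coordinates with
    respect to [d] independent ones, every point of the space is within
    [r = O(lam)] of [L].  Assigning to the points of a fine grid containing [L]
    the nearby points of [L] in an [L]-invariant way, the proportion of points of
    [L] in a convex set [C] differs from its volume by at most the volume of the
    [r]-neighbourhood of the boundaries of [C] and of the cube, which is [O(r)]. *)

(** * Badly approximable vectors *)

Lemma common_denominator (I : finType) (c : I -> rat) :
  exists (q : int) (m : I -> int),
    0 < q /\ forall i, c i * q%:~R = (m i)%:~R.
Proof.
exists (\prod_i denq (c i)), (fun i => numq (c i) * \prod_(j | j != i) denq (c j)).
split; first by apply: prodr_gt0 => i _; exact: denq_gt0.
move=> i; rewrite (bigD1 i) //= !intrM mulrA; congr (_ * _).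
by rewrite -{1}(divq_num_den (c i)) divfK // intr_eq0 denq_neq0.
Qed.

(** Each term of the Leibniz expansion has exactly one factor from row 0 and [n] factors from the
    other rows. *)
Lemma det_norm_le (R : realFieldType) (n : nat) (E : 'M[R]_n.+1) (a b : R) :
  (forall j, `|E ord0 j| <= a) ->
  (forall i j, i != ord0 -> `|E i j| <= b) ->
  `|\det E| <= (n.+1)`!%:R * (a * b ^+ n).
Proof.
move=> Ea Eb; rewrite /determinant.
apply: le_trans (ler_norm_sum _ _ _) _.
have -> : (n.+1)`!%:R * (a * b ^+ n) = \sum_(s : {perm 'I_n.+1}) (a * b ^+ n).
  by rewrite sumr_const card_Sn mulr_natl.
apply: ler_sum => s _; rewrite normrM normrX normrN1 expr1n mul1r normr_prod.
rewrite big_ord_recl; apply: ler_pM; rewrite ?prodr_ge0 //.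
have -> : b ^+ n = \prod_(i < n) b by rewrite prodr_const card_ord.
by apply: ler_prod => i _; rewrite normr_ge0 Eb.
Qed.

Lemma mulmx_norm_le (R : realFieldType) (m n : nat) (A : 'M[R]_(m, n))
    (x : 'cV[R]_n) (b : R) (i : 'I_m) :
  (forall k, `|x k 0| <= b) -> `|(A *m x) i 0| <= (\sum_i \sum_k `|A i k|) * b.
Proof.
move=> xb; rewrite mxE; apply: le_trans (ler_norm_sum _ _ _) _.
rewrite (bigD1 i) //= mulrDl -[leLHS]addr0 lerD //.
  by rewrite mulr_suml ler_sum // => k _; rewrite normrM ler_wpM2l.
rewrite mulr_suml sumr_ge0 // => j _; rewrite mulr_suml sumr_ge0 // => k _.
by rewrite mulr_ge0 // (le_trans _ (xb k)).
Qed.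

Section EigenvectorOfIntegerMatrices.
Variables (R : realFieldType) (d : nat) (v : 'cV[R]_d.+1).
Variables (A : 'I_d.+1 -> 'M[int]_d.+1) (q : int).
Hypothesis v0 : v ord0 0 = 1.
Hypothesis v_free : forall u : 'rV[rat]_d.+1, map_mx ratr u *m v = 0 -> u = 0.
Hypothesis q_gt0 : 0 < q.
Hypothesis Av : forall i, map_mx intr (A i) *m v = (q%:~R * v i 0) *: v.

Let D (w : 'cV[int]_d.+1) : 'M[int]_d.+1 := \matrix_(i, j) (A i *m w) j 0.

(** A rational relation [c] between the rows of [D w] makes [M = sum_i c_i A_i] kill [w], so [M] is
    singular and has a rational left null vector [u]. As [M v = q (c v) v], the product
    [(c v) (u v)] vanishes, although [c] and [u] are nonzero and the coordinates of [v] are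
    independent over the rationals. *)
Lemma conjugate_det_neq0 (w : 'cV[int]_d.+1) : w != 0 -> \det (D w) != 0.
Proof.
move=> w0; apply/eqP => Dw0.
have : \det (map_mx intr (D w) : 'M[rat]_d.+1) == 0.
  by rewrite det_map_mx Dw0 rmorph0.
case/det0P => c c0 cD.
pose M : 'M[rat]_d.+1 := \sum_i c 0 i *: map_mx intr (A i).
have Mw : M *m map_mx intr w = 0.
  apply/matrixP => j k; rewrite ord1 {k} mulmx_suml summxE [RHS]mxE.
  transitivity ((c *m map_mx intr (D w)) 0 j); last by rewrite cD mxE.
  rewrite [RHS]mxE; apply: eq_bigr => i _; rewrite [in RHS]mxE [D w i j]mxE.
  by rewrite -scalemxAl mxE -map_mxM mxE [c 0 i]lock !mxE -lock.
have Mv : map_mx ratr M *m v = (q%:~R * (map_mx ratr c *m v) 0 0) *: v.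
  have -> : map_mx ratr M = \sum_i ratr (c 0 i) *: map_mx intr (A i) :> 'M[R]_d.+1.
    rewrite /M raddf_sum /=; apply: eq_bigr => i _; rewrite map_mxZ.
    by congr (_ *: _); apply/matrixP => a b; rewrite !mxE /= ratr_int.
  rewrite mulmx_suml mxE mulr_sumr scaler_suml; apply: eq_bigr => i _.
  by rewrite -scalemxAl Av scalerA !mxE mulrCA.
have detM : \det M^T == 0.
  apply/det0P; exists (map_mx intr w)^T; last by rewrite -trmx_mul Mw trmx0.
  apply: contra w0 => /eqP/matrixP w0; apply/eqP/matrixP => i j.
  by move: (w0 j i); rewrite !mxE => /eqP; rewrite intr_eq0 => /eqP.
move: detM; rewrite det_tr => /det0P[u u0 uM].
have : map_mx ratr u *m (map_mx ratr M *m v) = 0.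
  by rewrite mulmxA -map_mxM uM map_mx0 mul0mx.
rewrite Mv -scalemxAr => /eqP; rewrite scaler_eq0 mulf_eq0 intr_eq0 gt_eqF //=.
case/orP => [/eqP cv|/eqP/v_free /eqP]; last by rewrite (negbTE u0).
have /v_free /eqP : map_mx ratr c *m v = 0.
  by apply/matrixP => i j; rewrite !ord1 cv mxE.
by rewrite (negbTE c0).
Qed.

Lemma simultaneous_approx_lower_bound :
  exists2 c : R, 0 < c & forall (w : 'cV[int]_d.+1) (e : R),
    0 < w ord0 0 -> 0 <= e <= 1 ->
    (forall i, `|(w ord0 0)%:~R * v i 0 - (w i 0)%:~R| <= e) ->
    c <= (w ord0 0)%:~R * e ^+ d.
Proof.
pose Ar i : 'M[R]_d.+1 := map_mx intr (A i).
pose S : R := \sum_i \sum_j \sum_k `|Ar i j k|.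
pose V : R := 1 + \sum_i `|v i 0|.
have V1 : 1 <= V by rewrite lerDl sumr_ge0.
have vV i : `|v i 0| + 1 <= V.
  by rewrite addrC lerD2l (bigD1 i) //= lerDl sumr_ge0.
have S0 : 0 <= S by rewrite !(sumr_ge0, normr_ge0)// => i _; rewrite sumr_ge0 // => j _; rewrite sumr_ge0.
have AS i (x : 'cV[R]_d.+1) (b : R) j : (forall k, `|x k 0| <= b) -> `|(Ar i *m x) j 0| <= S * b.
  move=> xb; have b0 : 0 <= b by rewrite (le_trans _ (xb ord0)).
  apply: le_trans (mulmx_norm_le (Ar i) j xb) _.
  rewrite ler_wpM2r // /S [leRHS](bigD1 i) //= lerDl.
  by apply: sumr_ge0 => a _; apply: sumr_ge0 => ? _; apply: sumr_ge0.
(* [B] dominates both [V * S], needed for row 0, and [S + V * S], needed for the reduced rows. *)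
pose B := 1 + 2 * V * S.
have B0 : 0 < B by rewrite ltr_pwDl // !mulr_ge0 // (le_trans _ V1).
exists ((d.+1)`!%:R * B ^+ d.+1)^-1.
  by rewrite invr_gt0 mulr_gt0 ?exprn_gt0 // ltr0n fact_gt0.
move=> w e w0 /andP[e0 e1] we.
set n : R := (w ord0 0)%:~R.
have n1 : 1 <= n by rewrite /n -[1]/(1%:~R) ler_int; lia.
(* Row [i] of [D w] is [n q v_i v] up to an error linear in [er]. The unitriangular [T] subtracts
   [v_i] times row 0 from it, which cancels this main term and leaves a row of size [O(e)]. *)
pose T : 'M[R]_d.+1 := \matrix_(i, j)
  ((i == j)%:R - (if (i != ord0) && (j == ord0) then v i 0 else 0)).
have detT : \det T = 1.
  rewrite det_trig.
    rewrite big1 // => i _; rewrite mxE eqxx.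
    by case: ifP => [/andP[/negP]|_]; rewrite ?subr0.
  apply/is_trig_mxP => i j ij; rewrite mxE.
  have -> : (i == j) = false by apply/negbTE; move: ij; rewrite -val_eqE /=; lia.
  have -> : (j == ord0) = false by apply/negbTE; move: ij; rewrite -val_eqE /=; lia.
  by rewrite andbF subr0.
pose Dr : 'M[R]_d.+1 := map_mx intr (D w).
pose wr : 'cV[R]_d.+1 := map_mx intr w.
pose er := wr - n *: v.
have DrE i j : Dr i j = (Ar i *m wr) j 0.
  by rewrite /Ar /wr -map_mxM !mxE.
have ere k : `|er k 0| <= e by rewrite !mxE distrC we.
have detD : \det (T *m Dr) = (\det (D w))%:~R.
  by rewrite det_mulmx detT mul1r det_map_mx.
have E0 j : `|(T *m Dr) ord0 j| <= B * n.
  have -> : (T *m Dr) ord0 j = Dr ord0 j.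
    rewrite mxE (bigD1 ord0) //= big1 ?addr0; last first.
      by move=> k k0; rewrite mxE eq_sym (negbTE k0) /= subr0 mul0r.
    by rewrite mxE /= subr0 mul1r.
  (* Since [e <= 1 <= n], the error of [w] is absorbed by the extra 1 in [V]. *)
  rewrite DrE; apply: le_trans (AS _ _ (V * n) _ _) _.
    move=> k; have -> : wr k 0 = n * v k 0 + er k 0 by rewrite !mxE; ring.
    apply: le_trans (ler_normD _ _) _; rewrite normrM ger0_norm ?(le_trans _ n1) //.
    have := vV k; have := ere k; nra.
  rewrite /B; have : 0 <= V * S * n by rewrite !mulr_ge0 // ?(le_trans _ V1) ?(le_trans _ n1).
  nra.
have E1 i j : i != ord0 -> `|(T *m Dr) i j| <= B * e.
  move=> i0.
  have -> : (T *m Dr) i j = Dr i j - v i 0 * Dr ord0 j.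
    rewrite mxE (bigD1 ord0) //= (bigD1 i) //= big1 ?addr0; last first.
      by move=> k /andP[k0 ki]; rewrite mxE (negbTE k0) andbF eq_sym (negbTE ki) subr0 mul0r.
    rewrite ![T _ _]mxE !eqxx (negbTE i0) /=; ring.
  have DE k : Dr k j = n * q%:~R * v k 0 * v j 0 + (Ar k *m er) j 0.
    rewrite DrE /er mulmxBr -scalemxAr Av; move: (Ar k *m wr) => X; rewrite !mxE; ring.
  rewrite !DE v0.
  have -> : n * q%:~R * v i 0 * v j 0 + (Ar i *m er) j 0
     - v i 0 * (n * q%:~R * 1 * v j 0 + (Ar ord0 *m er) j 0) =
     (Ar i *m er) j 0 - v i 0 * (Ar ord0 *m er) j 0 by ring.
  apply: le_trans (ler_normB _ _) _; rewrite normrM.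
  have h1 := AS i _ _ j ere; have h0 := AS ord0 _ _ j ere.
  have hv : `|v i 0| * `|(Ar ord0 *m er) j 0| <= V * (S * e).
    by apply: ler_pM => //; have := vV i; lra.
  have : 0 <= (V - 1) * (S * e) by rewrite !mulr_ge0 // subr_ge0.
  rewrite /B; lra.
have := det_norm_le E0 E1; rewrite detD => detle.
have : (1 : R) <= `|(\det (D w))%:~R|.
  rewrite -intr_norm -[1]/(1%:~R) ler_int.
  have : \det (D w) != 0.
    apply: conjugate_det_neq0; apply: contraTneq w0 => ->; by rewrite mxE ltxx.
  lia.
move/le_trans/(_ detle) => h.
have hE : B * n * (B * e) ^+ d = B ^+ d.+1 * (n * e ^+ d) by rewrite exprMn exprS; ring.
rewrite -[_^-1]mul1r ler_pdivrMr; last by rewrite mulr_gt0 ?exprn_gt0 // ltr0n fact_gt0.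
by rewrite mulrC -mulrA -hE.
Qed.

End EigenvectorOfIntegerMatrices.

(** Take [v = (1, alpha)]. Closure of the span under products gives multiplication by [v_i] a
    rational matrix in the basis [v]; a common denominator [q] turns it into an integer matrix [A i]
    with [A i v = q v_i v]. *)
Lemma badly_approximable (R : realType) (d : nat) (alpha : 'rV[R]_d) :
  Q_lin_indep alpha -> qspan_is_field alpha ->
  exists2 c : R, 0 < c & forall (n : nat) (k : 'I_d -> int) (e : R),
    (0 < n)%N -> 0 <= e <= 1 ->
    (forall j, `|n%:R * alpha 0 j - (k j)%:~R| <= e) -> c <= n%:R * e ^+ d.
Proof.
move=> indep [closM _].
pose v : 'cV[R]_d.+1 := \col_i oapp (fun j => alpha 0 j) 1 (unlift ord0 i).
have v0 : v ord0 0 = 1 by rewrite mxE unlift_none.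
have vS j : v (lift ord0 j) 0 = alpha 0 j by rewrite mxE liftK.
have v_qspan i : qspan alpha (v i 0).
  case: (unliftP ord0 i) => [j|] ->; rewrite ?v0 ?vS.
    exists 0, (fun k => (k == j)%:R); rewrite rmorph0 add0r (bigD1 j) //= eqxx rmorph1 mul1r.
    by rewrite big1 ?addr0 // => k /negbTE ->; rewrite rmorph0 mul0r.
  exists 1, (fun=> 0); rewrite rmorph1 big1 ?addr0 // => j _; by rewrite rmorph0 mul0r.
have /choice[c cE] (p : 'I_d.+1 * 'I_d.+1) :
    exists c : 'rV[rat]_d.+1, v p.1 0 * v p.2 0 = \sum_k ratr (c 0 k) * v k 0.
  have [c0 [q ->]] := closM _ _ (v_qspan p.1) (v_qspan p.2).
  exists (\row_i oapp q c0 (unlift ord0 i)); rewrite big_ord_recl v0 mulr1 mxE unlift_none.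
  by congr (_ + _); apply: eq_bigr => j _; rewrite mxE liftK vS.
have [q [m [q0 mE]]] := common_denominator (fun p : 'I_d.+1 * 'I_d.+1 * 'I_d.+1 => c p.1 0 p.2).
pose A i : 'M[int]_d.+1 := \matrix_(j, k) m (i, j, k).
have v_free (u : 'rV[rat]_d.+1) : map_mx ratr u *m v = 0 -> u = 0.
  move/matrixP/(_ 0 0); rewrite !mxE big_ord_recl v0 mulr1 mxE.
  under eq_bigr => j _ do rewrite vS mxE.
  move/indep => [u0 uS]; apply/matrixP => i j; rewrite ord1 mxE.
  by case: (unliftP ord0 j) => [k|] ->.
have Av i : map_mx intr (A i) *m v = (q%:~R * v i 0) *: v.
  apply/matrixP => j k; rewrite ord1 {k} [RHS]mxE -mulrA (cE (i, j)) mxE mulr_sumr.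
  apply: eq_bigr => k _; rewrite !mxE mulrA; congr (_ * _).
  have := mE ((i, j), k) => /= /(congr1 (ratr : rat -> R)).
  by rewrite rmorphM /= !ratr_int mulrC => <-.
have [c1 c10 H] := simultaneous_approx_lower_bound v0 v_free q0 Av.
exists c1 => // n k e n0 e01 nk.
pose w : 'cV[int]_d.+1 := \col_i oapp k n%:Z (unlift ord0 i).
have w0 : w ord0 0 = n%:Z by rewrite mxE unlift_none.
have := H w e; rewrite w0 pmulrn; apply=> //.
move=> i; case: (unliftP ord0 i) => [j|] ->.
  by rewrite vS [w _ _]mxE liftK /=; exact: nk.
by rewrite v0 w0 mulr1 subrr normr0; case/andP: e01.
Qed.

(** * Covering by a rank-1 lattice *)

Lemma frac_itv (R : realType) (x : R) : 0 <= frac x < 1.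
Proof. by rewrite /frac subr_ge0 floor_le ltrBlDl -intrD1 floorD1_gt. Qed.

Lemma truncn_eq_dist (R : realType) (q : nat) (x y : R) :
  (0 < q)%N -> 0 <= x -> 0 <= y ->
  Num.truncn (q%:R * x) = Num.truncn (q%:R * y) -> `|x - y| < q%:R^-1.
Proof.
move=> q0 x0 y0 e; have q0' : 0 < q%:R :> R by rewrite ltr0n.
have /andP[h1 h2] := truncn_itv (mulr_ge0 (ltW q0') x0).
have /andP[h3 h4] := truncn_itv (mulr_ge0 (ltW q0') y0).
rewrite -(ltr_pM2l q0') divff ?gt_eqF // -[X in X * `|_|]gtr0_norm // -normrM ltr_norml.
move: h1 h2 h3 h4; rewrite e -natr1 => h1 h2 h3 h4.
by apply/andP; split; lra.
Qed.

Lemma truncn_frac_lt (R : realType) (q : nat) (x : R) :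
  (0 < q)%N -> (Num.truncn (q%:R * frac x) < q)%N.
Proof.
move=> q0; have /andP[x0 x1] := frac_itv x.
have q0' : 0 < q%:R :> R by rewrite ltr0n.
rewrite -(ltr_nat R); apply: le_lt_trans (_ : _ <= q%:R * frac x) _.
  by rewrite truncn_le mulr_ge0 // ltW.
by rewrite gtr_pMr.
Qed.

(** Rounding [1 / (a lam)] and [(d + 1) / lam] up costs at most a factor 2 each, as both are at
    least 1. Hence [p q^d <= b / (a lam^(d+1))], which is below [c / lam^(d+1) <= N] once
    [a > b / c]. *)
Lemma pigeonhole_parameters (R : realType) (d : nat) (c : R) : 0 < c ->
  exists2 a : R, 1 <= a & forall (N : nat) (lam : R),
    0 < lam <= 1 -> c <= N%:R * lam ^+ d.+1 -> a * lam < 1 ->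
    exists p q : nat, [/\ (0 < p)%N, (0 < q)%N, p%:R^-1 <= a * lam,
      d.+1%:R / lam <= q%:R & (p * q ^ d < N)%N].
Proof.
move=> c0; set b : R := 2 * (2 * d.+1%:R) ^+ d.
have b0 : 0 < b by rewrite mulr_gt0 // exprn_gt0 // mulr_gt0 // ltr0n.
have a1 : 1 <= b / c + 1 by rewrite lerDr divr_ge0 // ltW.
exists (b / c + 1) => // N lam /andP[l0 l1] cN.
have {a1} : b / c < b / c + 1 by rewrite ltrDl.
have : 0 < b / c + 1 by rewrite addr_gt0 ?divr_gt0.
move: (b / c + 1) => a a0 ba al1.
have al0 : 0 < a * lam by rewrite mulr_gt0.
have h (x : R) : 1 <= x -> x <= (Num.truncn x).+1%:R <= 2 * x.
  move=> x1; have x0 : 0 <= x by rewrite (le_trans _ x1).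
  have /andP[h1 h2] := truncn_itv x0.
  rewrite ltW //= -natr1; lra.
have /h/andP[p1 p2] : 1 <= (a * lam)^-1 by rewrite invf_ge1 // ltW.
have d1 : 1 <= d.+1%:R :> R by rewrite ler1n.
have /h/andP[q1 q2] : 1 <= d.+1%:R / lam by rewrite ler_pdivlMr // mul1r (le_trans l1).
move: (Num.truncn _) p1 p2 => p p1 p2; move: (Num.truncn _) q1 q2 => q q1 q2.
exists p.+1, q.+1; split => //.
  by rewrite -(invrK (a * lam)) lef_pV2 // posrE ?ltr0n // invr_gt0.
rewrite -(ltr_nat R) natrM natrX -(ltr_pM2r (exprn_gt0 d.+1 l0)).
apply: lt_le_trans cN.
apply: (@le_lt_trans _ _ (2 / (a * lam) * (2 * (d.+1%:R / lam)) ^+ d * lam ^+ d.+1)).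
  rewrite ler_pM2r ?exprn_gt0 //; apply: ler_pM; rewrite ?exprn_ge0 //.
  apply: lerXn2r => //; rewrite nnegrE ?ler0n //.
  by apply: mulr_ge0 => //; apply: divr_ge0; rewrite ?ler0n ?(ltW l0).
have -> : 2 / (a * lam) * (2 * (d.+1%:R / lam)) ^+ d * lam ^+ d.+1 = b / a.
  rewrite /b mulrA exprMn exprVn exprS; field.
  by rewrite (gt_eqF a0) (gt_eqF l0) expf_neq0 // gt_eqF.
by rewrite ltr_pdivrMr // mulrC -ltr_pdivrMr.
Qed.

Section Covering.
Variables (R : realType) (d N : nat) (z : 'I_d.+1 -> int).

Definition rank1_lattice (x : 'rV[R]_d.+1) : Prop :=
  exists (n : int) (k : 'I_d.+1 -> int),
    forall j, x 0 j = n%:~R * (z j)%:~R / N%:R + (k j)%:~R.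

Lemma rank1_lattice_sum (I : finType) (f : I -> int) (x : I -> 'rV[R]_d.+1) :
  (forall i, rank1_lattice (x i)) ->
  rank1_lattice (\sum_i (f i)%:~R *: x i).
Proof.
move=> /choice[n /choice[k xE]].
exists (\sum_i f i * n i), (fun j => \sum_i f i * k i j) => j.
rewrite summxE !rmorph_sum /= !mulr_suml -big_split /=; apply: eq_bigr => i _.
by rewrite mxE xE !intrM; ring.
Qed.

Hypothesis N_gt0 : (0 < N)%N.
Variables (lam r : R).
Hypothesis lam_itv : 0 < lam <= 1.
Hypothesis lam_le_r : lam <= r.
Hypothesis min_norm : forall (n : nat) (k : 'I_d.+1 -> int),
  (0 < n < N)%N -> exists j, lam <= `|n%:R * (z j)%:~R / N%:R - (k j)%:~R|.
Hypothesis parameters : r < 1 -> exists p q : nat,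
  [/\ (0 < p)%N, (0 < q)%N, p%:R^-1 <= r,
      d.+1%:R / lam <= q%:R & (p * q ^ d < N)%N].

(* The points of the lattice in the unit cube are sorted into boxes that are
   long in a direction [j0] in which [u] is largest and shorter than [lam] by
   the factor [d + 1] in the others: a difference orthogonal to [u] of two
   points in the same box would contradict [min_norm]. *)
Lemma short_vector_off_hyperplane (u : 'cV[R]_d.+1) : u != 0 ->
  exists x : 'rV[R]_d.+1,
    [/\ rank1_lattice x, forall j, `|x 0 j| <= r & x *m u != 0].
Proof.
move=> u0; have /andP[l0 l1] := lam_itv.
pose j0 : 'I_d.+1 := [arg max_(i > ord0) `|u i 0|]%O.
have uj j : `|u j 0| <= `|u j0 0|.
  by rewrite /j0; case: arg_maxP => // i _; apply.
have uj0 : u j0 0 != 0.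
  apply: contra u0 => /eqP uj0; apply/eqP/matrixP => i k; rewrite ord1 mxE.
  by apply/eqP; rewrite -normr_le0 (le_trans (uj i)) // uj0 normr0.
(* If [1 <= r], a unit vector is short enough; only [r < 1] needs the pigeonhole argument. *)
have [r1|r1] := leP 1 r.
  exists (delta_mx 0 j0); split.
  - by exists 0, (fun j => (j == j0)%:Z) => j; rewrite mxE /= !mul0r add0r; case: eqP.
  - move=> j; rewrite mxE /=; case: eqP => _; rewrite ?normr1 ?normr0 //.
    by rewrite (le_trans _ r1).
  - rewrite -rowE; apply: contra uj0 => /eqP/matrixP/(_ 0 0); by rewrite !mxE => ->.
have [[|p] [[|q] [// _ // _ pr lq pqN]]] := parameters r1.
pose P (n : nat) j : R := frac (n%:R * (z j)%:~R / N%:R).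
pose f (n : 'I_N) : 'I_p.+1 * {ffun 'I_d -> 'I_q.+1} :=
  (inord (Num.truncn (p.+1%:R * P n j0)),
   [ffun j => inord (Num.truncn (q.+1%:R * P n (lift j0 j)))]).
have [n [m [mn fnm]]] : exists n m : 'I_N, (m < n)%N /\ f n = f m.
  have /injectivePn[n [m nm fnm]] : ~~ injectiveb f.
    by apply/negP => /injectiveP/leq_card; rewrite card_prod card_ffun !card_ord leqNgt pqN.
  case: (ltngtP n m) => h; [by exists m, n|by exists n, m|].
  by move: nm; rewrite -val_eqE /= h eqxx.
pose x : 'rV[R]_d.+1 := \row_j (P n j - P m j).
pose k j := Num.floor (n%:R * (z j)%:~R / N%:R : R) - Num.floor (m%:R * (z j)%:~R / N%:R : R).
have nm : (n - m)%:R = n%:R - m%:R :> R by rewrite natrB // ltnW.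
have xE j : x 0 j = (n - m)%:R * (z j)%:~R / N%:R - (k j)%:~R.
  by rewrite mxE /P /frac /k nm intrB; ring.
have frac0 a : 0 <= frac a :> R by case/andP: (frac_itv a).
have xj0 : `|x 0 j0| < p.+1%:R^-1.
  rewrite mxE; apply: truncn_eq_dist; rewrite /P //.
  move/(congr1 fst)/(congr1 val): fnm => /=.
  by rewrite !inordK // truncn_frac_lt.
have xj j : `|x 0 (lift j0 j)| < q.+1%:R^-1.
  rewrite mxE; apply: truncn_eq_dist; rewrite /P //.
  move/(congr1 snd)/ffunP/(_ j): fnm => /=; rewrite !ffunE => /(congr1 val) /=.
  by rewrite !inordK // truncn_frac_lt.
have q_lam : q.+1%:R^-1 <= lam / d.+1%:R.
  rewrite -[lam / _]invrK lef_pV2 ?posrE ?ltr0n // ?invr_gt0 ?divr_gt0 ?ltr0n //.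
  by rewrite invfM invrK mulrC.
have d1 : 1 <= d.+1%:R :> R by rewrite ler1n.
have lam_d : lam / d.+1%:R <= lam.
  by rewrite ler_pdivrMr ?ltr0n // ler_pMr.
exists x; split.
- exists (n - m)%N%:Z, (fun j => - k j) => j; rewrite xE intrN; congr (_ * _ / _ - _).
- move=> j; case: (unliftP j0 j) => [i|] ->; last by rewrite (le_trans (ltW xj0)).
  by rewrite (le_trans (ltW (xj i))) // (le_trans q_lam) // (le_trans lam_d).
(* Orthogonality expresses [x_j0 u_j0] through [d] terms of size at most [(lam / (d + 1)) |u_j0|],
   so [|x_j0| < lam] and every coordinate is below [lam]. *)
apply/eqP => /matrixP/(_ 0 0); rewrite !mxE (bigD1_ord j0) //= => xu.
have xu0 : `|x 0 j0| * `|u j0 0| <= d%:R * (lam / d.+1%:R) * `|u j0 0|.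
  rewrite -normrM; have -> : x 0 j0 * u j0 0 = - \sum_(i < d) x 0 (lift j0 i) * u (lift j0 i) 0.
    by apply/eqP; rewrite -addr_eq0 xu.
  rewrite normrN; apply: le_trans (ler_norm_sum _ _ _) _.
  rewrite -mulrA -[d in d%:R * _]card_ord mulr_natl -sumr_const.
  apply: ler_sum => i _; rewrite normrM; apply: ler_pM => //.
  by rewrite (le_trans (ltW (xj i))).
have {}xu0 : `|x 0 j0| < lam.
  move: xu0; rewrite ler_pM2r ?normr_gt0 // => /le_lt_trans; apply.
  by rewrite mulrCA gtr_pMr // ltr_pdivrMr ?ltr0n // mul1r ltr_nat.
have [|j] := min_norm k (n := (n - m)%N).
  by rewrite subn_gt0 mn (leq_ltn_trans (leq_subr _ _)).
apply/negP; rewrite -ltNge -xE.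
case: (unliftP j0 j) => [i|] -> //.
by rewrite (lt_le_trans (xj i)) // (le_trans q_lam).
Qed.

(** Rows are added one at a time: a nonzero column of [cokermx B] annihilates all rows of [B], so a
    short lattice vector not annihilated by it lies outside their span. *)
Lemma short_independent_vectors (k : nat) : (k <= d.+1)%N ->
  exists B : 'M[R]_(k, d.+1), [/\ \rank B = k,
    forall i, rank1_lattice (row i B) & forall i j, `|B i j| <= r].
Proof.
elim: k => [|k IH] kd.
  exists 0; split=> [|[]|[]] //; by rewrite mxrank0.
have [B [rB LB Br]] := IH (ltnW kd).
have : cokermx B != 0.
  by rewrite -mxrank_eq0 mxrank_coker rB -lt0n subn_gt0.
move=> /eqP/matrixP coker; have [j uj] : exists j, col j (cokermx B) != 0.
  apply: contrapT => h; apply: coker => i j; rewrite mxE.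
  have /eqP/matrixP/(_ i 0) : col j (cokermx B) == 0 by apply/negPn/negP => h'; apply: h; exists j.
  by rewrite !mxE.
have [x [Lx xr xu]] := short_vector_off_hyperplane uj.
exists (col_mx x B : 'M[R]_(1 + k, d.+1)); split.
- apply/eqP; rewrite eqn_leq rank_leq_row /=.
  have : (B < col_mx x B)%MS.
    rewrite ltmxE -addsmxE addsmxSr /=; apply: contra xu => xB.
    have /submxP[D ->] : (x <= B)%MS by apply: submx_trans xB; rewrite -addsmxE addsmxSl.
    by rewrite -mulmxA colE (mulmxA B) mulmx_coker mul0mx mulmx0.
  by rewrite ltmxErank rB => /andP[].
- move=> i; case: (@split_ordP 1 k i) => i' ->.
    suff -> : row (lshift k i') (col_mx x B : 'M[R]_(1 + k, d.+1)) = x by [].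
    by apply/rowP => j'; rewrite mxE [LHS](col_mxEu x B i' j') (ord1 i').
  suff -> : row (rshift 1 i') (col_mx x B : 'M[R]_(1 + k, d.+1)) = row i' B by [].
  by apply/rowP => j'; rewrite mxE [LHS](col_mxEd x B i' j') mxE.
- move=> i j'; rewrite mxE; case: (@fintype.split 1 k i) => i' //.
  by rewrite ord1.
Qed.

Lemma rank1_lattice_covering (x : 'rV[R]_d.+1) :
  exists (n : nat) (k : 'I_d.+1 -> int), (n < N)%N /\
    forall j, `|x 0 j - (n%:R * (z j)%:~R / N%:R + (k j)%:~R)| <= d.+1%:R * r.
Proof.
have [B [rB LB Br]] := short_independent_vectors (leqnn d.+1).
have uB : B \in unitmx by rewrite -row_full_unit /row_full rB.
pose t := x *m invmx B.
have [n [k yE]] := rank1_lattice_sum (fun i => Num.floor (t 0 i)) LB.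
set y := \sum_i _ in yE.
have xy j : `|x 0 j - y 0 j| <= d.+1%:R * r.
  have -> : x 0 j - y 0 j = \sum_i frac (t 0 i) * B i j.
    have -> : x = t *m B by rewrite mulmxKV.
    rewrite /y summxE mxE -sumrB; apply: eq_bigr => i _.
    by rewrite !mxE /frac mulrBl.
  apply: le_trans (ler_norm_sum _ _ _) _.
  rewrite -[d.+1 in leRHS]card_ord mulr_natl -sumr_const; apply: ler_sum => i _.
  have /andP[f0 f1] := frac_itv (t 0 i).
  by rewrite normrM ger0_norm // -[leRHS]mul1r ler_pM // ltW.
have N0 : N%:Z != 0 by rewrite eqz_nat -lt0n.
(* Reducing [n] modulo [N] changes the point by a multiple of the integral vector [z], which goes
   into the integral part. *)
exists `|(n %% N)%Z|%N, (fun j => k j + (n %/ N)%Z * z j); split.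
  have := ltz_mod n N0; have := modz_ge0 n N0; lia.
move=> j; have -> : `|(n %% N)%Z|%N%:R * (z j)%:~R / N%:R + (k j + (n %/ N)%Z * z j)%:~R = y 0 j :> R.
  have nE : `|(n %% N)%Z|%N%:R = n%:~R - (n %/ N)%Z%:~R * N%:R :> R.
    have /(congr1 (intr : int -> R)) := divz_eq n N; rewrite intrD intrM => ->.
    by rewrite !pmulrn gez0_abs ?modz_ge0 // addrC addKr.
  rewrite yE nE intrD intrM; field.
  by rewrite pnatr_eq0 -lt0n.
exact: xy.
Qed.
End Covering.

(** * The boundary of a convex set *)

Section Convex.
Variables (R : realType) (d : nat).
Implicit Types (C : set 'rV[R]_d) (x y : 'rV[R]_d) (r : R).

(** Convexity with plain real weights in place of the interval-typed weights of [convex_set]. *)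
Definition segment_closed C := forall x y (t : R),
  0 <= t <= 1 -> C x -> C y -> C (t *: x + (1 - t) *: y).

Lemma convex_set_segment_closed C :
  convex_set (C : set (convex_lmodType _)) -> segment_closed C.
Proof.
move=> cC x y t t01 Cx Cy.
have t_itv : Itv.spec (@Itv.num_sem R) (Itv.Real `[0%Z, 1%Z]) t.
  by apply/andP; split; rewrite ?num_real //= in_itv /= t01.
have := cC x y (Itv.mk t_itv).
by rewrite !inE; apply.
Qed.

Lemma segment_closed_sum C (I : finType) (w : I -> 'rV[R]_d) (l : I -> R) :
  segment_closed C -> (forall i, C (w i)) -> (forall i, 0 <= l i) ->
  \sum_i l i = 1 -> C (\sum_i l i *: w i).
Proof.
move=> cC Cw l0 l1.
(* The induction runs over normalised partial sums. When the tail has total weight 0, all its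
   weights vanish and only the head remains. *)
have key (s : seq I) : 0 < \sum_(i <- s) l i ->
    C ((\sum_(i <- s) l i)^-1 *: \sum_(i <- s) l i *: w i).
  elim: s => [|i s IH]; first by rewrite big_nil ltxx.
  rewrite !big_cons.
  have : 0 <= \sum_(i <- s) l i by rewrite sumr_ge0.
  rewrite le_eqVlt => /predU1P[s0|s0] is0.
    have -> : \sum_(j <- s) l j *: w j = 0.
      rewrite big_seq big1 // => j js.
      have : \sum_(i <- s) l i == 0 by rewrite -s0.
      rewrite psumr_eq0 // => /allP/(_ j js) /= /eqP ->; exact: scale0r.
    move: is0; rewrite -s0 !addr0 => li; rewrite scalerA mulVf ?scale1r //.
    by rewrite gt_eqF.
  move: (IH s0) is0; set p := \sum_(i <- s) l i in s0 *.
  set S := \sum_(i <- s) _ => CS is0.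
  have -> : (l i + p)^-1 *: (l i *: w i + S) =
      (l i / (l i + p)) *: w i + (1 - l i / (l i + p)) *: (p^-1 *: S).
    rewrite scalerDr !scalerA; congr (_ *: _ + _ *: _); field; rewrite ?gt_eqF //.
  apply: cC => //; rewrite divr_ge0 ?(ltW is0) //=.
  by rewrite ler_pdivrMr // mul1r lerDl ltW.
by have := key (index_enum I); rewrite l1 invr1 scale1r; apply.
Qed.

Definition thickening C r : set 'rV[R]_d :=
  [set x | exists2 y, C y & forall j, `|y 0 j - x 0 j| <= r].

Lemma thickening_segment_closed C r :
  segment_closed C -> segment_closed (thickening C r).
Proof.
move=> cC x y t t01 [x' Cx' xx'] [y' Cy' yy'].
exists (t *: x' + (1 - t) *: y'); first exact: cC.
move=> j; rewrite !mxE.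
have -> : t * x' 0 j + (1 - t) * y' 0 j - (t * x 0 j + (1 - t) * y 0 j) =
  t * (x' 0 j - x 0 j) + (1 - t) * (y' 0 j - y 0 j) by ring.
apply: le_trans (ler_normD _ _) _; case/andP: t01 => t0 t1.
have t1' : 0 <= 1 - t by rewrite subr_ge0.
rewrite !normrM (ger0_norm t0) (ger0_norm t1').
have := ler_wpM2l t0 (xx' j); have := ler_wpM2l t1' (yy' j); lra.
Qed.

(** At the index [j0] where [|x|] is largest, [(x H)_j0] differs from [t x_j0] by at most
    [d r |x_j0|]. The case [b = 0] yields invertibility of [H]. *)
Lemma diag_dominant_bound (H : 'M[R]_d) (t r b : R) (x : 'rV[R]_d) :
  (forall i j, `|H i j - t *+ (i == j)| <= r) ->
  (forall j, `|(x *m H) 0 j| <= b) ->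
  forall j, `|x 0 j| * (t - d%:R * r) <= b.
Proof.
move=> Hr xb j1.
pose j0 := [arg max_(i > j1) `|x 0 i|]%O.
have xj j : `|x 0 j| <= `|x 0 j0|.
  by rewrite /j0; case: arg_maxP => // i _; apply.
have [t0|t0] := leP (t - d%:R * r) 0.
  by rewrite (le_trans _ (le_trans (normr_ge0 _) (xb j1))) // mulr_ge0_le0.
apply: le_trans (_ : `|x 0 j0| * (t - d%:R * r) <= b).
  by rewrite ler_pM2r.
have xHE : (x *m H) 0 j0 = t * x 0 j0 + \sum_i x 0 i * (H i j0 - t *+ (i == j0)).
  rewrite mxE; under [in RHS]eq_bigr => i _ do rewrite mulrBr.
  rewrite sumrB [X in _ + (_ - X)](bigD1 j0) //= eqxx mulr1n.
  rewrite [X in _ + (_ - (_ + X))]big1 ?addr0; first by rewrite mulrC; ring.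
  by move=> i /negbTE ->; rewrite mulr0n mulr0.
have err : `|\sum_i x 0 i * (H i j0 - t *+ (i == j0))| <= d%:R * (`|x 0 j0| * r).
  apply: le_trans (ler_norm_sum _ _ _) _.
  have -> : d%:R * (`|x 0 j0| * r) = \sum_(i < d) (`|x 0 j0| * r).
    by rewrite sumr_const card_ord mulr_natl.
  by apply: ler_sum => i _; rewrite normrM ler_pM.
have t1 : t <= `|t| := ler_norm t.
have := xb j0; rewrite xHE => h.
have : `|t * x 0 j0| <= b + d%:R * (`|x 0 j0| * r).
  rewrite -[t * _](addrK (\sum_i x 0 i * (H i j0 - t *+ (i == j0)))).
  by apply: le_trans (ler_normB _ _) _; rewrite lerD.
rewrite normrM => h'.
have := ler_wpM2r (normr_ge0 (x 0 j0)) t1; lra.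
Qed.
End Convex.

Definition signed_unit (R : realType) (d : nat) (p : 'I_d * bool) : 'rV[R]_d :=
  (-1) ^+ p.2 *: delta_mx 0 p.1.

Section Escape.
Variables (R : realType) (d : nat).

(* Otherwise the convex set contains points close to the vertices of a large
   cross-polytope, and hence the point [y']. *)
Lemma escape_direction (C : set 'rV[R]_d.+1) (r : R) (y y' : 'rV[R]_d.+1) :
  0 < r -> segment_closed C -> ~ C y' -> (forall j, `|y' 0 j - y 0 j| <= r) ->
  exists p, ~ thickening C r (y + (3 * d.+1%:R * r) *: signed_unit R p).
Proof.
move=> r0 cC nCy' yy'; apply: contrapT => /forallNP h.
set D : R := d.+1%:R in h; set t := 3 * D * r in h.
have D1 : 1 <= D by rewrite ler1n.
have D0 : 0 < D by rewrite ltr0n.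
have /choice[w wP] (p : 'I_d.+1 * bool) : exists w, C w /\
    forall j, `|w 0 j - (y 0 j + t * ((-1) ^+ p.2 * (j == p.1)%:R))| <= r.
  have /contrapT[w Cw wr] := h p; exists w; split => // j.
  by have := wr j; rewrite !mxE eqxx.
(* [c] is the mean of the points [w] near the vertices, and the rows of [H] are the half-differences
   of opposite ones. Solving [y' = c + x H] gives [y'] the weights [1 / (2 D) + x_i / 2] and
   [1 / (2 D) - x_i / 2], nonnegative when [|x_i| <= 1 / D]. As [|y' - c| <= 2 r], this follows from
   the margin [t - D r = 2 D r], whence the 3 in [t]. *)
pose H : 'M[R]_d.+1 := \matrix_(i, j) ((w (i, false) 0 j - w (i, true) 0 j) / 2).
pose c : 'rV[R]_d.+1 := (2 * D)^-1 *: \sum_p w p.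
have HE i j : `|H i j - t *+ (i == j)| <= r.
  have [_ /(_ j)] := wP (i, false); have [_ /(_ j)] := wP (i, true).
  rewrite /= mxE expr0 expr1 !ler_norml (eq_sym j).
  case: (i == j); rewrite ?mulr1n ?mulr0n => /andP[? ?] /andP[? ?]; apply/andP; split; lra.
have sum_pairs (F : 'I_d.+1 * bool -> R) :
    \sum_p F p = \sum_i (F (i, false) + F (i, true)).
  rewrite (eq_bigr (fun p => F (p.1, p.2))); last by case.
  rewrite -(pair_bigA _ (fun i b => F (i, b))) /=; apply: eq_bigr => i _.
  by rewrite big_bool addrC.
have cy j : `|c 0 j - y 0 j| <= r.
  rewrite mxE summxE sum_pairs.
  have -> : (2 * D)^-1 * (\sum_i (w (i, false) 0 j + w (i, true) 0 j)) - y 0 j =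
     (2 * D)^-1 * \sum_i (w (i, false) 0 j + w (i, true) 0 j - 2 * y 0 j).
    rewrite sumrB sumr_const card_ord -mulr_natl -/D; field.
    by rewrite gt_eqF.
  rewrite normrM gtr0_norm ?invr_gt0 ?mulr_gt0 // ler_pdivrMl ?mulr_gt0 //.
  apply: le_trans (ler_norm_sum _ _ _) _.
  have -> : 2 * D * r = \sum_(i < d.+1) (2 * r).
    by rewrite sumr_const card_ord -mulr_natl -/D; ring.
  apply: ler_sum => i _.
  have [_ /(_ j)] := wP (i, false); have [_ /(_ j)] := wP (i, true).
  rewrite /= expr0 expr1 !ler_norml.
  by move=> /andP[? ?] /andP[? ?]; apply/andP; split; lra.
have uH : H \in unitmx.
  rewrite unitmxE unitfE; apply/negP => /det0P[x /negP x0 xH]; apply: x0.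
  apply/eqP/matrixP => i j; rewrite ord1 mxE; apply/eqP; rewrite -normr_le0.
  have := @diag_dominant_bound R _ H t r 0 x HE _ j.
  rewrite -/D /t => /(_ _)/wrap[|]; first by move=> k; rewrite xH mxE normr0.
  have -> : 3 * D * r - D * r = 2 * D * r by ring.
  by rewrite pmulr_lle0 // !mulr_gt0.
pose x := (y' - c) *m invmx H.
have xH : x *m H = y' - c by rewrite mulmxKV.
have xHE k : (x *m H) 0 k = y' 0 k - c 0 k.
  have sub_E (a b : 'rV[R]_d.+1) : (a - b) 0 k = a 0 k - b 0 k by rewrite !mxE.
  by rewrite xH sub_E.
have xD j : `|x 0 j| <= D^-1.
  have := @diag_dominant_bound R _ H t r (2 * r) x HE _ j.
  rewrite -/D /t => /(_ _)/wrap[|].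
    move=> k; rewrite xHE; have := yy' k; have := cy k.
    by rewrite !ler_norml => /andP[? ?] /andP[? ?]; apply/andP; split; lra.
  have -> : 3 * D * r - D * r = 2 * D * r by ring.
  move=> hx; rewrite -[D^-1]mul1r ler_pdivlMr //.
  by rewrite -(ler_pM2r (_ : 0 < 2 * r)) ?mulr_gt0 //; lra.
pose l (p : 'I_d.+1 * bool) : R := (2 * D)^-1 + (-1) ^+ p.2 * x 0 p.1 / 2.
apply: nCy'; have -> : y' = \sum_p l p *: w p.
  apply/matrixP => i j; rewrite ord1 summxE.
  rewrite (eq_bigr (fun p => l p * w p 0 j)) => [|p _]; last by rewrite mxE.
  rewrite sum_pairs.
  have -> : y' 0 j = c 0 j + (x *m H) 0 j by rewrite xHE; ring.
  rewrite [c _ _]mxE summxE sum_pairs [(x *m H) _ _]mxE mulr_sumr -big_split /=.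
  apply: eq_bigr => k _; rewrite [H _ _]mxE.
  by rewrite /l /= expr0 expr1; field; rewrite gt_eqF.
apply: segment_closed_sum => //.
- by move=> p; case: (wP p).
- move=> [i b]; rewrite /l /=; have := xD i; rewrite ler_norml.
  have -> : (2 * D)^-1 = D^-1 / 2 by rewrite invfM mulrC.
  by move: (D^-1) => D' /andP[? ?]; case: b; rewrite /= ?expr0 ?expr1; lra.
- rewrite sum_pairs (eq_bigr (fun=> D^-1)).
    by rewrite sumr_const card_ord -mulr_natl divff // gt_eqF.
  by move=> i _; rewrite /l /= expr0 expr1; field; rewrite gt_eqF.
Qed.
End Escape.

(** * Counting the grid points near the boundary of a convex set *)

Section Grid.
Variables (R : realType) (d K : nat).
Implicit Types (C : set 'rV[R]_d.+1) (g : 'rV['I_K.+1]_d.+1).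

Definition grid_pt g : 'rV[R]_d.+1 := \row_j ((g 0 j)%:R / K.+1%:R).

Definition near_boundary C r g : bool :=
  `[< thickening C r (grid_pt g) /\ thickening (~` C) r (grid_pt g) >].

(** Assign to each such point an escape direction. On one axis-parallel line, two points with the
    same direction are less than [t] apart: otherwise the escape point of one would lie on the
    segment joining them, inside the convex thickening. So direction, line and position modulo
    [M.+1] determine the point. *)
Lemma card_near_boundary C (r : R) : 0 < r -> segment_closed C ->
  (#|near_boundary C r| <=
     d.+1 * 2 * K.+1 ^ d * (Num.truncn (3 * d.+1%:R * r * K.+1%:R)).+1)%N.
Proof.
move=> r0 cC; set t := 3 * d.+1%:R * r; set M := Num.truncn (t * K.+1%:R).
have t0 : 0 < t by rewrite !mulr_gt0.
have K0 : 0 < K.+1%:R :> R by rewrite ltr0n.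
have MtK : t < M.+1%:R / K.+1%:R.
  by rewrite ltr_pdivlMr // /M truncnS_gt.
have /choice[p pP] g : exists p, near_boundary C r g ->
    ~ thickening C r (grid_pt g + t *: signed_unit R p).
  case: (boolP (near_boundary C r g)) => [/asboolP[_ [y' Cy' yy']]|]; last by exists (ord0, true).
  by have [p] := escape_direction r0 cC Cy' yy'; exists p.
pose phi g : 'I_d.+1 * bool * {ffun 'I_d -> 'I_K.+1} * 'I_M.+1 :=
  (p g, [ffun k => g 0 (lift (p g).1 k)], inord (g 0 (p g).1 %% M.+1)).
have -> : (d.+1 * 2 * K.+1 ^ d * M.+1)%N =
    #|{: 'I_d.+1 * bool * {ffun 'I_d -> 'I_K.+1} * 'I_M.+1}|.
  by rewrite !card_prod card_ffun !card_ord card_bool.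
suff phi_inj : {in near_boundary C r &, injective phi}.
  by rewrite -(card_in_imset phi_inj) max_card.
have key g g' : near_boundary C r g -> near_boundary C r g' -> p g = p g' ->
    (forall k, g 0 (lift (p g).1 k) = g' 0 (lift (p g).1 k)) ->
    (t <= (-1) ^+ (p g).2 * (grid_pt g' 0 (p g).1 - grid_pt g 0 (p g).1)) -> False.
  move=> bg bg' pgg' gg' tle; apply: (pP g bg).
  set s := _ * _ in tle; set e := signed_unit R (p g).
  have s0 : 0 < s by rewrite (lt_le_trans t0).
  have g'E : grid_pt g' = grid_pt g + s *: e.
    apply/matrixP => i j; rewrite ord1 [RHS]mxE [X in _ = _ + X]mxE.
    rewrite [e _ _]mxE [delta_mx _ _ _ _]mxE eqxx /=.
    case: (unliftP (p g).1 j) => [k|] ->.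
      by rewrite eq_sym (negbTE (neq_lift _ _)) !mulr0 addr0 !mxE gg'.
    by rewrite eqxx mulr1 /s mulrAC -expr2 sqrr_sign mul1r addrC subrK.
  have -> : grid_pt g + t *: e = (1 - t / s) *: grid_pt g + (1 - (1 - t / s)) *: grid_pt g'.
    by rewrite g'E subKr scalerDr scalerA divfK ?gt_eqF // addrA -scalerDl subrK scale1r.
  case/asboolP: bg => bg _; case/asboolP: bg' => bg' _.
  apply: (thickening_segment_closed cC) => //.
  rewrite subr_ge0 ler_pdivrMr // mul1r tle /= lerBlDr lerDl divr_ge0 // ltW //.
move=> g g' bg bg' [pgg' gg' modgg'].
have {}gg' k : g 0 (lift (p g).1 k) = g' 0 (lift (p g).1 k).
  by have /ffunP/(_ k) := gg'; rewrite !ffunE -pgg'.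
have {}modgg' : g 0%R (p g).1 = g' 0%R (p g).1 %[mod M.+1].
  by have /(congr1 val) := modgg'; rewrite /= -pgg' !inordK // ltn_mod.
(* Distinct congruent positions differ by at least [M.+1] grid steps, which exceeds [t]. *)
have far g1 g2 (j : 'I_d.+1) : (g1 0%R j < g2 0%R j)%N -> g1 0%R j = g2 0%R j %[mod M.+1] ->
    t <= grid_pt g2 0 j - grid_pt g1 0 j.
  move=> lt12 e12; rewrite !mxE -mulrBl -natrB 1?ltnW // ltW // (lt_le_trans MtK) //.
  rewrite ler_pM2r ?invr_gt0 // ler_nat dvdn_leq ?subn_gt0 //.
  by rewrite -eqn_mod_dvd 1?ltnW // e12.
suff e : g 0 (p g).1 = g' 0 (p g).1.
  apply/matrixP => i j; rewrite ord1.
  by case: (unliftP (p g).1 j) => [k|] ->.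
apply: val_inj => /=.
have gg's k : g' 0 (lift (p g').1 k) = g 0 (lift (p g').1 k) by rewrite -pgg' gg'.
case: (ltngtP (g 0 (p g).1) (g' 0 (p g).1)) => // lt12; exfalso.
- have f := far _ _ _ lt12 modgg'.
  case b : (p g).2.
    apply: (key g' g) => //; rewrite -pgg' b expr1.
    by move: f; lra.
  by apply: (key g g') => //; rewrite b expr0 mul1r.
- have f := far _ _ _ lt12 (esym modgg').
  case b : (p g).2.
    apply: (key g g') => //; rewrite b expr1.
    by move: f; lra.
  by apply: (key g' g) => //; rewrite -pgg' b expr0 mul1r.
Qed.
End Grid.

(* Replace the indicator of [X] at [g] by the average of the indicator of [S]
   over the [n] such that [h n] is close to [g]. *)
Lemma equidistribution_up_to_bad (R : realFieldType) (A T : finZmodType)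
    (h : A -> T) (P : pred T) (S : pred A) (X bad : pred T) :
  {morph h : a b / a + b} ->
  (forall g, exists n, P (g - h n)) ->
  (forall g n, ~~ bad g -> P (g - h n) -> S n = X g) ->
  `|#|S|%:R * (#|T|%:R / #|A|%:R) - #|X|%:R| <= #|bad|%:R :> R.
Proof.
move=> hD cov good.
(* [W g] counts the lattice points close to [g]; it is positive by covering and invariant under
   translation by the image of [h]. *)
pose W g : R := \sum_n (P (g - h n))%:R.
have W0 g : 0 < W g.
  have [n Pn] := cov g; rewrite /W (bigD1 n) //= Pn ltr_pwDl //.
  by rewrite sumr_ge0 // => m _; rewrite ler0n.
have WD g a : W (g + h a) = W g.
  rewrite /W (reindex_inj (addrI a)) /=; apply: eq_bigr => n _.
  by rewrite hD opprD addrA addrK.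
have cardE (U : finType) (Y : pred U) : #|Y|%:R = \sum_g (Y g)%:R :> R.
  rewrite -sum1_card natr_sum big_mkcond /=; apply: eq_bigr => g _.
  by rewrite unfold_in; case: (Y g).
(* By invariance each [n] receives the same total weight [w] when [g] varies. Taking all of [A] for
   [B] then identifies [w] with [#|T| / #|A|]. *)
pose w := \sum_g (P g)%:R / W g.
have sumS (B : pred A) :
    \sum_g (\sum_n (B n)%:R * (P (g - h n))%:R) / W g = #|B|%:R * w.
  under eq_bigr => g _ do rewrite mulr_suml.
  rewrite exchange_big cardE [RHS]mulr_suml /=.
  apply: eq_bigr => n _.
  rewrite /w mulr_sumr (reindex_inj (addIr (h n))) /=; apply: eq_bigr => g _.
  by rewrite addrK WD mulrA.
have A0 : #|A|%:R != 0 :> R.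
  by rewrite pnatr_eq0 -lt0n; apply/card_gt0P; exists 0.
have wE : #|T|%:R / #|A|%:R = w :> R.
  apply/eqP; rewrite eq_sym -[eqbLHS](mulfK A0); apply/eqP; congr (_ / _).
  rewrite mulrC -(sumS predT) -sum1_card natr_sum; apply: eq_bigr => g _.
  rewrite -[RHS](divff (lt0r_neq0 (W0 g))); congr (_ / _).
  by apply: eq_bigr => n _; rewrite mul1r.
rewrite wE -sumS !cardE -sumrB; apply: le_trans (ler_norm_sum _ _ _) _.
apply: ler_sum => g _.
have avg01 : 0 <= (\sum_n (S n)%:R * (P (g - h n))%:R) / W g <= 1.
  apply/andP; split.
    apply: divr_ge0; last exact: ltW.
    by apply: sumr_ge0 => n _; rewrite mulr_ge0 ?ler0n.
  rewrite ler_pdivrMr // mul1r ler_sum // => n _.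
  by case: (S n); rewrite ?mul1r // mul0r ler0n.
have [badg|nbad] := boolP (bad g).
  move: avg01; move: (_ / _) => a /andP[a0 a1].
  by rewrite ler_norml; case: (X g) => /=; apply/andP; split; lra.
suff -> : \sum_n (S n)%:R * (P (g - h n))%:R = (X g)%:R * W g.
  by rewrite mulfK ?gt_eqF // subrr normr0.
rewrite /W mulr_sumr; apply: eq_bigr => n _.
have [Pn|] := boolP (P (g - h n)); last by rewrite !mulr0.
by rewrite (good g n).
Qed.

(** * Volume and grid points *)

(** This allows the boxes of a cover to be enlarged to open ones at a controlled cost in volume. *)
Lemma prod_shift_le (R : realFieldType) (I : finType) (v : I -> R) (e : R) :
  (forall i, 0 <= v i) -> 0 < e ->
  exists2 t : R, 0 < t & \prod_i (v i + t) <= \prod_i v i + e.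
Proof.
move=> v0 e0.
(* The bound is claimed for all shifts up to [t], so that the induction may shrink [t]. *)
suff H (s : seq I) (e1 : R) : 0 < e1 -> exists2 t : R, 0 < t &
    forall x, 0 <= x <= t -> \prod_(i <- s) (v i + x) <= \prod_(i <- s) v i + e1.
  by have [t t0 tP] := H (index_enum I) e e0; exists t => //; apply: tP; rewrite ltW /=.
elim: s e1 => [|i s IH] e1 e10.
  by exists 1 => // x _; rewrite !big_nil lerDl ltW.
have P0 : 0 <= \prod_(j <- s) v j by apply: prodr_ge0.
have vi := v0 i.
have [|t t0 tP] := IH (e1 / (2 * (v i + 1))).
  by rewrite divr_gt0 // mulr_gt0 // ltr_wpDl.
set e2 := e1 / _ in tP.
have e20 : 0 < e2 by rewrite divr_gt0 // mulr_gt0 // ltr_wpDl.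
set P := \prod_(j <- s) v j in P0 tP *.
have Pe0 : 0 < P + e2 by rewrite ltr_wpDl.
exists (Num.min t (e1 / (2 * (P + e2)))).
  by rewrite lt_min t0 divr_gt0 // mulr_gt0.
move=> x; rewrite le_min => /and3P[x0 xt xe]; rewrite !big_cons -/P.
apply: le_trans (_ : (v i + x) * (P + e2) <= _).
  by rewrite ler_wpM2l ?addr_ge0 // tP // x0.
have h1 : x * (P + e2) <= e1 / 2.
  by rewrite -ler_pdivlMr // -mulrA -invfM.
have h2 : v i * e2 <= e1 / 2.
  have -> : e1 / 2 = (v i + 1) * e2 by rewrite /e2; field; rewrite gt_eqF // ltr_wpDl.
  by rewrite ler_wpM2r ?(ltW e20) // lerDl.
rewrite mulrDl mulrDr; lra.
Qed.

Lemma card_grid_itv (R : realType) (L : nat) (a b : R) : a <= b ->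
  #|[pred i : 'I_L.+1 | a <= i%:R / L.+1%:R <= b]|%:R <= (b - a) * L.+1%:R + 1.
Proof.
move=> ab; set P := [pred i | _].
have L0 : 0 < L.+1%:R :> R by rewrite ltr0n.
have abL0 : 0 <= (b - a) * L.+1%:R by rewrite mulr_ge0 ?subr_ge0 // ltW.
have [i0 Pi0|P0] := pickP P; last by rewrite eq_card0 // addr_ge0.
case: (arg_minnP (fun i : 'I_L.+1 => i : nat) Pi0) => m Pm mP.
set n := Num.truncn ((b - a) * L.+1%:R).
have mn i : P i -> (i - m < n.+1)%N.
  move=> Pi; rewrite ltnS /n truncn_ge_nat // natrB ?mP //.
  move: Pi Pm; rewrite !inE => /andP[_ +] /andP[+ _].
  by rewrite ler_pdivrMr // ler_pdivlMr // mulrBl => ? ?; lra.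
have inj : {in P &, injective (fun i : 'I_L.+1 => inord (i - m) : 'I_n.+1)}.
  move=> i j Pi Pj /(congr1 val); rewrite /= !inordK ?mn // => e.
  by apply: val_inj => /=; rewrite -(subnK (mP _ Pi)) -(subnK (mP _ Pj)) e.
apply: le_trans (_ : n.+1%:R <= _).
  rewrite ler_nat -(card_ord n.+1) -(card_in_image inj); exact: max_card.
by rewrite -natr1 lerD2r /n truncn_le.
Qed.

Lemma card_grid_box (R : realType) (d L : nat) (a b : 'rV[R]_d) :
  (forall j, a 0 j <= b 0 j) ->
  #|[pred y : {ffun 'I_d -> 'I_L.+1} |
      [forall j, a 0 j <= (y j)%:R / L.+1%:R <= b 0 j]]|%:R
  <= \prod_j ((b 0 j - a 0 j) * L.+1%:R + 1).
Proof.
move=> ab.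
have -> : #|[pred y : {ffun 'I_d -> 'I_L.+1} |
      [forall j, a 0 j <= (y j)%:R / L.+1%:R <= b 0 j]]| =
   #|family (fun j => [pred i : 'I_L.+1 | a 0 j <= i%:R / L.+1%:R <= b 0 j])|.
  by apply: eq_card => y; rewrite !inE; apply: eq_forallb.
rewrite card_family foldrE big_map big_enum /= natr_prod.
by apply: ler_prod => j _; rewrite ler0n card_grid_itv.
Qed.

Section Volume.
Variables (R : realType) (d : nat).
Local Notation D := d.+1.
Implicit Types (A : set 'rV[R]_D).

(** The cells are closed, so that finite unions of them are compact. *)
Definition grid_cell (K : nat) (g : 'rV['I_K.+1]_D) : set 'rV[R]_D :=
  box (grid_pt R g) (grid_pt R g + const_mx K.+1%:R^-1).

Lemma box_vol_ge0 (a b : 'rV[R]_D) : (forall j, a 0 j <= b 0 j) -> 0 <= box_vol a b.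
Proof. by move=> ab; apply: prodr_ge0 => j _; rewrite subr_ge0. Qed.

(* Count the points of a grid [M] times finer. *)
Lemma card_cells_le_boxes (K M n : nat) (G : {set 'rV['I_K.+1]_D})
    (a b : nat -> 'rV[R]_D) :
  (forall k j, a k 0 j <= b k 0 j) ->
  (forall g x, g \in G -> grid_cell g x -> exists2 k, (k < n)%N & box (a k) (b k) x) ->
  #|G|%:R / K.+1%:R ^+ D <=
    \sum_(k < n) \prod_j (b k 0 j - a k 0 j + (K.+1 * M.+1)%:R^-1).
Proof.
move=> ab cover; set L := (K.+1 * M.+1).-1.
have LE : L.+1 = (K.+1 * M.+1)%N by rewrite /L prednK // muln_gt0.
pose Y k : pred {ffun 'I_D -> 'I_L.+1} :=
    fun y => [forall j, a k 0 j <= (y j)%:R / L.+1%:R <= b k 0 j].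
have lt_L (g : 'I_K.+1) (m : 'I_M.+1) : (g * M.+1 + m < L.+1)%N.
  rewrite LE; apply: leq_trans (_ : (g * M.+1 + M.+1 <= _)%N).
    by rewrite ltn_add2l.
  by rewrite addnC -mulSn leq_mul2r ltn_ord orbT.
(* The cell index and the offset are digits in base [M.+1]. Offsets stop at [M], so no fine point is
   counted for two cells although closed cells share faces. *)
pose phi (p : 'rV['I_K.+1]_D * {ffun 'I_D -> 'I_M.+1}) : {ffun 'I_D -> 'I_L.+1} :=
  [ffun j => inord (p.1 0%R j * M.+1 + p.2 j)].
have phiE p j : phi p j = (p.1 0%R j * M.+1 + p.2 j)%N :> nat by rewrite ffunE inordK.
have phi_inj : injective phi.
  move=> [g m] [g' m'] e.
  have ej j : (g 0%R j * M.+1 + m j = g' 0%R j * M.+1 + m' j)%N.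
    by rewrite -(phiE (g, m)) -(phiE (g', m')) e.
  congr pair.
    apply/matrixP => i j; rewrite ord1; apply: val_inj => /=.
    have /(congr1 (divn^~ M.+1)) := ej j.
    by rewrite !divnMDl // !divn_small ?ltn_ord // !addn0.
  apply/ffunP => j; apply: val_inj => /=.
  have /(congr1 (modn^~ M.+1)) := ej j.
  by rewrite !modnMDl !modn_small ?ltn_ord.
have K0 : 0 < K.+1%:R :> R by rewrite ltr0n.
have M0 : 0 < M.+1%:R :> R by rewrite ltr0n.
have LR : L.+1%:R = K.+1%:R * M.+1%:R :> R by rewrite LE natrM.
have phi_cover g m : g \in G -> exists k : 'I_n, Y k (phi (g, m)).
  move=> gG.
  pose x : 'rV[R]_D := \row_j ((phi (g, m) j)%:R / L.+1%:R).
  have cx : grid_cell g x.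
    move=> j; rewrite !mxE phiE /= LR natrD natrM.
    have -> : ((g 0 j)%:R * M.+1%:R + (m j)%:R) / (K.+1%:R * M.+1%:R) =
        (g 0 j)%:R / K.+1%:R + K.+1%:R^-1 * ((m j)%:R / M.+1%:R) :> R.
      by field; rewrite !gt_eqF.
    rewrite lerDl lerD2l mulr_ge0 ?divr_ge0 ?invr_ge0 ?ler0n //=.
    by rewrite ler_piMr ?invr_ge0 ?ler0n // ler_pdivrMr // mul1r ler_nat ltnW.
  have [k kn bx] := cover g x gG cx; exists (Ordinal kn).
  by apply/forallP => j; have := bx j; rewrite mxE.
have key : (#|G| * M.+1 ^ D)%N%:R <= \sum_(k < n) #|Y k|%:R :> R.
  have -> : (#|G| * M.+1 ^ D)%N = #|phi @: finset.setX G [set: {ffun 'I_D -> 'I_M.+1}]%SET|.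
    by rewrite card_imset // cardsX cardsT card_ffun !card_ord.
  rewrite -sum1_card natr_sum.
  apply: le_trans (_ : \sum_(y : {ffun 'I_D -> 'I_L.+1}) \sum_(k < n) (Y k y)%:R <= _).
    rewrite big_mkcond /=; apply: ler_sum => y _.
    case: ifP => [/imsetP[[g m]]|_]; last by apply: sumr_ge0 => k _; rewrite ler0n.
    rewrite finset.inE => /andP[gG _] ->; have [k Yk] := phi_cover g m gG.
    by rewrite (bigD1 k) // Yk lerDl sumr_ge0 // => i _; rewrite ler0n.
  rewrite exchange_big /=; apply: ler_sum => k _.
  rewrite -sum1_card natr_sum [leRHS]big_mkcond /=; apply: ler_sum => y _.
  by have -> : (y \in Y k) = Y k y by []; case: (Y k y); rewrite lexx.
rewrite ler_pdivrMr ?exprn_gt0 // -(ler_pM2r (exprn_gt0 D M0)).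
move: key; rewrite natrM natrX => /le_trans; apply.
rewrite mulr_suml mulr_suml; apply: ler_sum => k _.
apply: le_trans (card_grid_box L (ab k)) _.
rewrite -mulrA -exprMn -LR -LE.
have -> : L.+1%:R ^+ D = \prod_(j < D) L.+1%:R :> R by rewrite prodr_const card_ord.
rewrite -big_split /=; apply: ler_prod => j _.
have L0 : 0 < L.+1%:R :> R by rewrite ltr0n.
rewrite [X in _ <= _ <= X](mulrDl (_ - _)) mulVf ?gt_eqF // lexx andbT.
by rewrite addr_ge0 // mulr_ge0 ?subr_ge0 // ltW.
Qed.

Lemma compact_cells (K : nat) (G : {set 'rV['I_K.+1]_D}) :
  compact (\big[setU/set0]_(g in G) grid_cell g).
Proof.
apply: bigsetU_compact => g _.
have := @rV_compact _ D (fun j => `[grid_pt R g 0 j, (grid_pt R g + const_mx K.+1%:R^-1) 0 j]%classic).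
move=> /(_ (fun j => @segment_compact R _ _)); congr compact.
Qed.

Lemma open_box (a b : 'rV[R]_D) :
  open [set x : 'rV[R]_D | forall j, a 0 j < x 0 j < b 0 j].
Proof.
rewrite openE => x /= xab.
exists (fun i j => `]a 0 j, b 0 j[%classic) => /=.
  move=> i j; rewrite ord1; apply: open_nbhs_nbhs; split; first exact: interval_open.
  by rewrite /= in_itv /= xab.
by move=> y /= yab j; have := yab 0 j; rewrite in_itv.
Qed.

(** [vol] is an infimum over countable covers, so a lower bound needs compactness: the boxes are
    enlarged to open ones, a finite subcover is extracted and the counting bound applies to it. *)
Lemma vol_ge_cells (K : nat) (G : {set 'rV['I_K.+1]_D}) A :
  (forall g, g \in G -> grid_cell g `<=` A) ->
  ((#|G|%:R / K.+1%:R ^+ D)%:E <= vol A)%E.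
Proof.
move=> GA; apply: le_ereal_inf_tmp => _ [a [b [ab Acover ->]]].
apply/lee_addgt0Pr => e e0.
(* The costs [e / 2 ^+ k.+1] sum to less than [e] over any finite range. *)
have /choice[t tP] k : exists t : R, 0 < t /\
    \prod_j (b k 0 j - a k 0 j + t) <= box_vol (a k) (b k) + e / 2 ^+ k.+1.
  have [||t t0 tle] := @prod_shift_le R _ (fun j => b k 0 j - a k 0 j) (e / 2 ^+ k.+1).
  - by move=> j; rewrite subr_ge0.
  - by rewrite divr_gt0 // exprn_gt0.
  by exists t.
have t0 k : 0 < t k by case: (tP k).
(* Two thirds of [t k] enlarge the box on its two sides; the last third absorbs the step of the
   finer grid. *)
pose a' k : 'rV[R]_D := a k - const_mx (t k / 3).
pose b' k : 'rV[R]_D := b k + const_mx (t k / 3).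
have a'b' k j : a' k 0 j <= b' k 0 j.
  by rewrite !mxE; have := ab k j; have := t0 k; lra.
have [n nP] : exists n, forall g x, g \in G -> grid_cell g x ->
    exists2 k, (k < n)%N & box (a' k) (b' k) x.
  have := @compact_cells K G; rewrite compact_cover.
  move=> /(_ nat setT (fun k => [set x : 'rV[R]_D | forall j, a' k 0 j < x 0 j < b' k 0 j])).
  case=> [k _|x|F _ FP].
  - exact: open_box.
  - rewrite -bigcup_seq_cond => -[g /= /andP[_ gG] gx].
    have [k _ kx] := Acover x (GA g gG x gx); exists k => // j.
    by have := kx j; rewrite !mxE; have := t0 k; lra.
  exists (\max_(k <- finmap.enum_fset F) k.+1)%N => g x gG gx.
  have [|k /= kF kx] := FP x.
    by rewrite -bigcup_seq_cond; exists g => //=; rewrite mem_index_enum.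
  exists k; first exact: (@leq_bigmax_seq _ _ xpredT (fun k => k.+1) k kF).
  by move=> j; have /andP[/ltW -> /ltW ->] := kx j.
have [M MP] : exists M, forall k, (k < n)%N -> (K.+1 * M.+1)%:R^-1 <= t k / 3.
  pose u : R := \sum_(k < n) 3 / t k.
  exists (Num.truncn u) => k kn.
  have tk := t0 k.
  have uk : 3 / t k <= u.
    rewrite /u (bigD1 (Ordinal kn)) //= lerDl sumr_ge0 // => i _.
    by rewrite divr_ge0 // ltW.
  rewrite -[t k / 3]invrK lef_pV2 ?posrE ?invr_gt0 ?divr_gt0 ?ltr0n ?muln_gt0 //.
  rewrite invf_div natrM (le_trans uk) // (le_trans (ltW (truncnS_gt u))) //.
  by rewrite ler_peMl ?ler0n // ler1n.
have := card_cells_le_boxes M a'b' nP.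
set S := \sum_(k < n) _ => GS.
have SE : S <= \sum_(k < n) box_vol (a k) (b k) + e.
  apply: le_trans (_ : S <= \sum_(k < n) (box_vol (a k) (b k) + e / 2 ^+ k.+1)) _.
    apply: ler_sum => k _; have [_ tk] := tP k.
    apply: le_trans tk; apply: ler_prod => j _.
    have := MP k (ltn_ord k); have := ab k j.
    rewrite !mxE => abj Mk; apply/andP; split.
      by rewrite addr_ge0 ?invr_ge0 ?ler0n //; have := t0 k; lra.
    suff : b k 0 j + t k / 3 - (a k 0 j - t k / 3) + t k / 3 <= b k 0 j - a k 0 j + t k.
      by apply: le_trans; rewrite lerD2l.
    by have -> : b k 0 j + t k / 3 - (a k 0 j - t k / 3) + t k / 3 = b k 0 j - a k 0 j + t k by field.
  rewrite big_split /= lerD2l.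
  have -> : \sum_(k < n) e / 2 ^+ k.+1 = e * (1 - 2^-1 ^+ n).
    elim: (n) => [|m IH]; first by rewrite big_ord0 expr0 subrr mulr0.
    by rewrite big_ord_recr /= IH -exprVn exprS; field.
  by rewrite ler_piMr ?(ltW e0) // gerBl exprn_ge0 // invr_ge0.
apply: le_trans (_ : ((\sum_(k < n) box_vol (a k) (b k) + e)%:E <= _)%E).
  by rewrite lee_fin (le_trans GS).
rewrite EFinD leeD2r // -sumEFin -(big_mkord xpredT (fun k => (box_vol (a k) (b k))%:E)).
by apply: nneseries_lim_ge => k _ _; rewrite lee_fin box_vol_ge0.
Qed.

Lemma vol_le_cells (K : nat) (G : {set 'rV['I_K.+1]_D}) A :
  (forall x, A x -> exists2 g, g \in G & grid_cell g x) ->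
  (vol A <= (#|G|%:R / K.+1%:R ^+ D)%:E)%E.
Proof.
move=> AG; apply: ereal_inf_lbound.
pose e := enum G.
pose a k : 'rV[R]_D := nth 0 [seq grid_pt R g | g <- e] k.
(* Past the list of cells the boxes degenerate to a point, of volume 0 because the dimension is
   positive. *)
pose b k : 'rV[R]_D := if (k < size e)%N then a k + const_mx K.+1%:R^-1 else a k.
have K0 : 0 < K.+1%:R^-1 :> R by rewrite invr_gt0 ltr0n.
exists a, b; split.
- by move=> k j; rewrite /b; case: ifP => // _; rewrite !mxE lerDl ltW.
- move=> x /AG[g gG gx].
  have ie : (index g e < size e)%N by rewrite index_mem mem_enum.
  exists (index g e) => //; rewrite /b ie /a (nth_map 0) // nth_index // mem_enum //.
have volk k : (k < size e)%N -> box_vol (a k) (b k) = (K.+1%:R ^+ D)^-1.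
  move=> ke; rewrite /box_vol /b ke -exprVn.
  under eq_bigr => j _ do rewrite !mxE addrAC subrr add0r.
  by rewrite prodr_const card_ord.
rewrite (@nneseries_split _ _ 0 (size e)).
  rewrite eseries0 ?adde0 => [|i ie _]; last first.
    rewrite /box_vol /b ltnNge -(add0n (size e)) ie /= (bigD1 ord0) //= subrr mul0r //.
  rewrite add0n big_mkord sumEFin (eq_bigr (fun=> (K.+1%:R ^+ D)^-1)) => [|i _]; last exact: volk.
  by rewrite sumr_const card_ord -cardE mulr_natl.
move=> k _; rewrite lee_fin box_vol_ge0 // => j; rewrite /b; case: ifP => // _.
by rewrite !mxE lerDl ltW.
Qed.
End Volume.

(** * Discrepancy of a covering lattice *)

Lemma frac_unique (R : realType) (x y : R) (k : int) :
  x = y + k%:~R -> 0 <= y < 1 -> frac x = y.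
Proof.
move=> -> /andP[y0 y1]; rewrite /frac (@floor_def _ _ k) ?addrK //.
by rewrite lerDr y0 intrD [_ + 1%:~R]addrC ltrD2r.
Qed.

(** Integer numerators over [N] place the lattice points on any grid whose mesh divides [1 / N]. *)
Lemma lattice_pt_modn (R : realType) (d N : nat) (z : 'I_d -> int) (n : nat) (j : 'I_d) :
  (0 < N)%N ->
  @lattice_pt R d N z n 0 j = ((n * `|(z j %% N)%Z|) %% N)%N%:R / N%:R.
Proof.
move=> N0; rewrite mxE; set y := `|_|%N.
have NR : 0 < N%:R :> R by rewrite ltr0n.
have yE : y%:Z = (z j %% N)%Z by rewrite /y gez0_abs // modz_ge0 // eqz_nat -lt0n.
have zE : (z j)%:~R = (z j %/ N)%Z%:~R * N%:R + y%:R :> R.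
  by have /(congr1 (intr : int -> R)) := divz_eq (z j) N; rewrite intrD intrM -yE.
apply: (@frac_unique _ _ _ (((n * y) %/ N)%N%:Z + n%:Z * (z j %/ N)%Z)%R).
  have /(congr1 (fun k : nat => k%:R : R)) := divn_eq (n * y) N.
  rewrite natrD !natrM zE intrD intrM => e.
  have -> : n%:R * ((z j %/ N)%Z%:~R * N%:R + y%:R) =
    n%:R * (z j %/ N)%Z%:~R * N%:R + n%:R * y%:R :> R by ring.
  by rewrite e -!pmulrn; field; rewrite gt_eqF.
by rewrite divr_ge0 ?ler0n //= ltr_pdivrMr // mul1r ltr_nat ltn_mod.
Qed.

(** Addition in ['I_K.+1] is modulo [K.+1]: the grid is a finite subgroup of the torus, and
    [grid_pt] is additive only up to integers. *)
Lemma grid_ptD (R : realType) (d K : nat) (g g' : 'rV['I_K.+1]_d.+1) :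
  exists k : 'I_d.+1 -> int, forall j,
    grid_pt R (g + g') 0 j = grid_pt R g 0 j + grid_pt R g' 0 j - (k j)%:~R.
Proof.
exists (fun j => ((g 0%R j + g' 0%R j) %/ K.+1)%N%:Z) => j; rewrite !mxE /=.
have /(congr1 (fun k : nat => k%:R : R)) := divn_eq (g 0%R j + g' 0%R j) K.+1.
rewrite [LHS]natrD [RHS]natrD natrM => e.
have K0 : K.+1%:R != 0 :> R by rewrite pnatr_eq0.
rewrite -mulrDl e -pmulrn mulrDl mulfK //; ring.
Qed.

Lemma unit_cube_segment_closed (R : realType) (d : nat) : segment_closed (@unit_cube R d).
Proof.
move=> x y t /andP[t0 t1] Cx Cy j; rewrite !mxE.
have /andP[x0 x1] := Cx j; have /andP[y0 y1] := Cy j.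
have t1' : 0 <= 1 - t by rewrite subr_ge0.
rewrite addr_ge0 ?mulr_ge0 //=.
move: t0; rewrite le_eqVlt => /predU1P[<-|t0]; first by rewrite mul0r add0r subr0 mul1r.
have : t * x 0 j < t by rewrite gtr_pMr.
have := ler_wpM2l t1' (ltW y1); lra.
Qed.

Lemma grid_pt_unit_cube (R : realType) (d K : nat) (g : 'rV['I_K.+1]_d.+1) :
  unit_cube (grid_pt R g).
Proof.
move=> j; rewrite mxE divr_ge0 ?ler0n //= ltr_pdivrMr ?ltr0n //.
by rewrite mul1r ltr_nat.
Qed.

Lemma near_boundary_dist (R : realType) (d K : nat) (C : set 'rV[R]_d.+1) (r : R)
    (g : 'rV['I_K.+1]_d.+1) (x : 'rV[R]_d.+1) :
  0 <= r -> (forall j, `|x 0 j - grid_pt R g 0 j| <= r) ->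
  ~~ near_boundary C r g -> C x <-> C (grid_pt R g).
Proof.
move=> r0 xg /asboolPn nb.
have self A : A (grid_pt R g) -> thickening A r (grid_pt R g).
  by exists (grid_pt R g) => // j; rewrite subrr normr0.
split=> Cx; apply: contrapT => nC; apply: nb; split; try exact: self.
- by exists x.
- by exists x.
Qed.

(** The factor [2 * d.+1] counts the escape directions, [3 * d.+1] comes from the escape distance,
    and the final 1 from rounding. *)
Definition boundary_constant (R : realType) (d : nat) : R :=
  2 * d.+1%:R * (3 * d.+1%:R + 1).

Section DiscrepancyOfCovering.
Variables (R : realType) (d N : nat) (z : 'I_d.+1 -> int) (r : R).
Local Notation D := d.+1.
Hypothesis N_gt0 : (0 < N)%N.
Hypothesis r_gt0 : 0 < r.
Hypothesis covering : forall x : 'rV[R]_D, exists (n : nat) (k : 'I_D -> int),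
  (n < N)%N /\ forall j, `|x 0 j - (n%:R * (z j)%:~R / N%:R + (k j)%:~R)| <= r.
Variable C : set 'rV[R]_D.
Hypothesis C_cube : C `<=` @unit_cube R D.
Hypothesis C_convex : segment_closed C.

Local Notation cB := (boundary_constant R d).

Lemma near_boundary_density (A : set 'rV[R]_D) (K : nat) :
  1 <= r * K.+1%:R -> segment_closed A ->
  #|@near_boundary R d K A r|%:R <= cB * r * K.+1%:R ^+ D.
Proof.
move=> rK Aconv; have := card_near_boundary K r_gt0 Aconv.
rewrite -(ler_nat R) => /le_trans; apply.
rewrite natrM natrM natrM natrX /boundary_constant exprS.
set M := (Num.truncn _).+1.
have M_le : M%:R <= (3 * D%:R + 1) * (r * K.+1%:R).
  rewrite /M -natr1.
  have x0 : 0 <= 3 * D%:R * r * K.+1%:R by rewrite !mulr_ge0 ?ler0n // ltW.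
  have : (Num.truncn (3 * D%:R * r * K.+1%:R))%:R <= 3 * D%:R * r * K.+1%:R by rewrite truncn_le.
  lra.
have -> : 2 * D%:R * (3 * D%:R + 1) * r * (K.+1%:R * K.+1%:R ^+ d) =
  D%:R * 2 * K.+1%:R ^+ d * ((3 * D%:R + 1) * (r * K.+1%:R)) by ring.
by rewrite ler_wpM2l // !mulr_ge0 ?ler0n ?exprn_ge0.
Qed.

Section FineGrid.
Variables (m : nat).
Hypothesis m_gt0 : (0 < m)%N.
(** A grid with [N * m] steps per axis contains all the lattice points. *)
Let K := (N * m).-1.
Hypothesis rK : 1 <= r * K.+1%:R.
Let KE : K.+1 = (N * m)%N. Proof. by rewrite prednK // muln_gt0 N_gt0. Qed.
Local Notation T := 'rV['I_K.+1]_D.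
Let X : pred T := fun g => `[< C (grid_pt R g) >].
Let bC : pred T := near_boundary C r.

Let K_gt0 : 0 < K.+1%:R :> R. Proof. by rewrite ltr0n. Qed.

Let step_le : K.+1%:R^-1 <= r.
Proof. by rewrite -[_^-1]mul1r ler_pdivrMr. Qed.

Let card_bC : #|bC|%:R <= cB * r * K.+1%:R ^+ D.
Proof. exact: near_boundary_density. Qed.

Let cell_dist (g : T) x : grid_cell g x -> forall j, `|x 0 j - grid_pt R g 0 j| <= r.
Proof.
move=> gx j; have /andP[h1] := gx j; rewrite mxE [const_mx _ _ _]mxE => h2.
by rewrite ger0_norm ?subr_ge0 // lerBlDl (le_trans h2) // lerD2l.
Qed.

(** A cell has side at most [r], so if it meets [C] its corner is in [C] or near the boundary;
    corners of the latter kind account for [cB * r]. *)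
Lemma vol_le_grid : (vol C <= (#|X|%:R / K.+1%:R ^+ D + cB * r)%:E)%E.
Proof.
pose G := [set g : T | X g || bC g]%SET.
have cover x : C x -> exists2 g, g \in G & grid_cell g x.
  move=> Cx; pose g : T := \row_j inord (Num.truncn (K.+1%:R * x 0 j)).
  have gx : grid_cell g x.
    move=> j; have /andP[x0 x1] := C_cube Cx j.
    have Kx0 : 0 <= K.+1%:R * x 0 j by rewrite mulr_ge0 // ltW.
    rewrite !mxE inordK; last first.
      by rewrite truncn_lt_nat // gtr_pMr.
    have /andP[h1 h2] := truncn_itv Kx0.
    rewrite -[X in _ <= _ <= _ + X]mul1r -mulrDl natr1.
    by rewrite ler_pdivrMr // ler_pdivlMr // ![x 0 j * _]mulrC h1 ltW.
  exists g => //; rewrite finset.inE; case: (boolP (bC g)) => [|nb]; rewrite ?orbT // orbF.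
  by apply/asboolP/(near_boundary_dist (ltW r_gt0) (cell_dist gx) nb).
apply: le_trans (vol_le_cells cover) _; rewrite lee_fin.
have KD : 0 < K.+1%:R ^+ D :> R by rewrite exprn_gt0.
rewrite ler_pdivrMr // mulrDl divfK ?gt_eqF //.
apply: le_trans (_ : (#|X| + #|bC|)%:R <= _).
  rewrite ler_nat -cardUI; apply: leq_trans (leq_addr _ _).
  by apply: subset_leq_card; apply/fintype.subsetP => g; rewrite finset.inE !inE.
by rewrite natrD lerD2l.
Qed.

Lemma vol_ge_grid : ((#|X|%:R / K.+1%:R ^+ D - cB * r)%:E <= vol C)%E.
Proof.
pose G := [set g : T | X g && ~~ bC g]%SET.
have inC g : g \in G -> grid_cell g `<=` C.
  rewrite finset.inE => /andP[/asboolP Cg nb] x gx.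
  by apply/(near_boundary_dist (ltW r_gt0) (cell_dist gx) nb).
apply: le_trans (vol_ge_cells inC); rewrite lee_fin.
have KD : 0 < K.+1%:R ^+ D :> R by rewrite exprn_gt0.
rewrite ler_pdivlMr // mulrBl divfK ?gt_eqF // lerBlDr.
apply: le_trans (_ : (#|G| + #|bC|)%:R <= _); last by rewrite natrD lerD2l.
rewrite ler_nat -cardUI; apply: leq_trans (leq_addr _ _).
apply: subset_leq_card; apply/fintype.subsetP => g Xg.
have {}Xg : X g by [].
have -> : (g \in [predU G & bC]) = (X g && ~~ bC g) || bC g.
  by rewrite !inE.
by rewrite Xg /= orNb.
Qed.

(** The averaging lemma is applied to the embedding [h] of the integers modulo [N] into the grid,
    with closeness taken modulo integral vectors. Bad points are those near the boundary of [C] or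
    of the cube, hence the factor 2. *)
Lemma count_near_grid :
  `|(lattice_count N z C)%:R / N%:R - #|X|%:R / K.+1%:R ^+ D| <= 2 * (cB * r).
Proof.
have NE : N = N.-1.+1 by rewrite prednK.
pose y j := `|(z j %% N)%Z|%N.
have NR : 0 < N%:R :> R by rewrite ltr0n.
have mR : 0 < m%:R :> R by rewrite ltr0n.
pose h (n : 'I_N.-1.+1) : T := \row_j inord ((n * y j) %% N * m).
have h_lt (n : nat) j : ((n * y j) %% N * m < K.+1)%N.
  by rewrite KE ltn_pmul2r // ltn_mod.
have hE n j : h n 0 j = ((n * y j) %% N * m)%N :> nat by rewrite mxE inordK.
have h_pt n : grid_pt R (h n) = lattice_pt R N z n.
  apply/matrixP => i j; rewrite ord1 mxE hE lattice_pt_modn // KE !natrM -/(y j).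
  by field; rewrite !gt_eqF.
have hD : {morph h : a b / a + b}.
  move=> a b; apply/matrixP => i j; rewrite ord1 [RHS]mxE; apply: ord_inj.
  rewrite hE /= !hE /=.
  move: (nat_of_ord a) (nat_of_ord b) => a1 b1.
  rewrite -NE modnMml mulnDl KE -(mulnDl _ _ m) -muln_modl modnDm.
  by [].
pose P : pred T := fun g =>
  `[< exists k : 'I_D -> int, forall j, `|grid_pt R g 0 j - (k j)%:~R| <= r >].
have PE g n : P (g - h n) <-> exists k : 'I_D -> int,
    forall j, `|lattice_pt R N z n 0 j + (k j)%:~R - grid_pt R g 0 j| <= r.
  have [k kE] := grid_ptD R (g - h n) (h n); move: kE; rewrite subrK h_pt => kE.
  split=> [/asboolP[l lP]|[l lP]].
    exists (fun j => l j - k j) => j; have := lP j; rewrite kE distrC intrB.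
    by congr (`|_| <= _); ring.
  apply/asboolP; exists (fun j => l j + k j) => j; have := lP j.
  by rewrite kE distrC intrD; congr (`|_| <= _); ring.
pose S : pred 'I_N.-1.+1 := fun n => `[< C (lattice_pt R N z n) >].
have cov g : exists n, P (g - h n).
  have [n [k [nN nk]]] := covering (grid_pt R g).
  have nN' : (n < N.-1.+1)%N by rewrite -NE.
  exists (Ordinal nN'); apply/PE.
  exists (fun j => k j + Num.floor (n%:R * (z j)%:~R / N%:R : R)) => j.
  have := nk j; rewrite distrC !mxE /frac intrD /=; congr (`|_| <= _); ring.
pose bad : pred T := [predU bC & near_boundary (@unit_cube R D) r].
have good g n : ~~ bad g -> P (g - h n) -> S n = X g.
  rewrite negb_or => /andP[nbC nbQ] /PE[k kP].
  pose x : 'rV[R]_D := \row_j (lattice_pt R N z n 0 j + (k j)%:~R).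
  have xg j : `|x 0 j - grid_pt R g 0 j| <= r by rewrite mxE kP.
  have /(near_boundary_dist (ltW r_gt0) xg nbQ) Qx := @grid_pt_unit_cube R d K g.
  (* Away from the boundary of the cube there is no wrap-around: [x] and the lattice point both lie
     in the half-open cube and differ by an integral vector. *)
  have xE : x = lattice_pt R N z n.
    apply/matrixP => i j; rewrite ord1; have := Qx j; rewrite mxE.
    have /andP[p0 p1] : 0 <= @lattice_pt R _ N z n 0 j < 1 by rewrite mxE frac_itv.
    move=> /andP[q0 q1].
    have k1 : (k j)%:~R < 1%:~R :> R by lra.
    have k0 : (-1)%:~R < (k j)%:~R :> R by rewrite intrN; lra.
    move: k0 k1; rewrite !ltr_int => k0 k1.
    have -> : k j = 0 by move: (k j) k0 k1; clear => l; lia.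
    by rewrite addr0.
  rewrite /S /X -xE; apply: asbool_equiv_eq.
  exact: (near_boundary_dist (ltW r_gt0) xg nbC).
have := equidistribution_up_to_bad R hD cov good.
rewrite card_mx !card_ord mul1n natrX -NE.
have -> : #|S| = lattice_count N z C.
  rewrite /lattice_count /S.
  have cast M : M = N -> #|[pred n : 'I_M | `[< C (lattice_pt R N z n) >]]| =
      #|[set n : 'I_N | lattice_pt R N z n \in C]|.
    move=> ->; apply: eq_card => n.
    by apply/asboolP/idP; rewrite in_setE /= in_setE.
  by rewrite -(cast _ (esym NE)).
have bad_le : #|bad|%:R <= 2 * (cB * r) * K.+1%:R ^+ D.
  apply: le_trans (_ : (#|bC| + #|@near_boundary R d K (@unit_cube R D) r|)%:R <= _).
    by rewrite ler_nat -cardUI leq_addr.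
  rewrite natrD -mulrA mulr_natl mulr2n lerD //.
  exact: (near_boundary_density rK (@unit_cube_segment_closed _ _)).
move=> /le_trans/(_ bad_le).
have KD : 0 < K.+1%:R ^+ D :> R by rewrite exprn_gt0.
rewrite -[X in _ -> `|X| <= _](mulfK (lt0r_neq0 KD)) normrM normfV (gtr0_norm KD).
rewrite ler_pdivrMr // mulrBl divfK ?gt_eqF //.
by congr (`|_ - _| <= _); field; rewrite gt_eqF.
Qed.
End FineGrid.

Lemma discrepancy_of_covering :
  (`|((lattice_count N z C)%:R / N%:R)%:E - vol C| <= (3 * (cB * r))%:E)%E.
Proof.
(* As [m > 1 / r], the mesh is below [r]. Counting contributes [2 * (cB * r)] and volume [cB * r],
   hence the 3. *)
pose m := (Num.truncn r^-1).+1.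
have rK : 1 <= r * (N * m).-1.+1%:R.
  rewrite prednK ?muln_gt0 ?N_gt0 // natrM.
  rewrite -ler_pdivrMl // mulr1 (le_trans (ltW (truncnS_gt _))) //.
  by rewrite ler_peMl ?ler0n // ler1n.
have hcount := @count_near_grid m isT rK.
have hle := @vol_le_grid m rK; have hge := @vol_ge_grid m rK.
move: hle hge hcount; case: (vol C) => [v| |] //.
rewrite -EFinB abse_EFin !lee_fin !ler_norml => h1 h2 /andP[h3 h4].
by apply/andP; split; lra.
Qed.

End DiscrepancyOfCovering.

(** * Best approximations *)

Lemma dist_int_le (R : realType) (x : R) (k : int) : dist_int x <= `|x - k%:~R|.
Proof.
rewrite /dist_int ge_min; have /andP[fx xf] := floor_itv x.
have [kf|fk] := leP k (Num.floor x).
  apply/orP; left; rewrite ger0_norm ?subr_ge0; last first.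
    by rewrite (le_trans _ fx) // ler_int.
  by rewrite lerD2l lerN2 ler_int.
apply/orP; right; have fk' : (Num.floor x)%:~R + 1 <= k%:~R :> R.
  by rewrite -intrD1 ler_int lezD1.
rewrite distrC ger0_norm; first by rewrite lerD2r.
rewrite subr_ge0 (le_trans _ fk') // ltW //.
by move: xf; rewrite intrD.
Qed.

Lemma nearest_int_dist (R : realType) (x : R) : `|x - (nearest_int x)%:~R| = dist_int x.
Proof.
apply/eqP; rewrite eq_le dist_int_le andbT /dist_int le_min.
have /andP[fx xf] := floor_itv x; rewrite intrD in xf.
have /andP[nx xn] := floor_itv (x + 2^-1); rewrite intrD in xn.
rewrite -/(nearest_int x) in nx xn.
set f := (Num.floor x)%:~R in fx xf *; set n : R := (nearest_int x)%:~R in nx xn *.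
have [nE|nE] : n = f \/ n = f + 1.
  have h1 : (Num.floor x)%:~R <= (nearest_int x)%:~R :> R.
    by rewrite ler_int /nearest_int le_floor // lerDl invr_ge0.
  have h2 : (nearest_int x)%:~R < (Num.floor x + 2)%:~R :> R.
    by rewrite intrD -/f -/n; lra.
  move: h1 h2; rewrite ler_int ltr_int /n /f; move: (nearest_int x) (Num.floor x) => a b.
  clear=> h1 h2; have [->|->] : a = b \/ a = b + 1 by lia.
    by left.
  by right; rewrite intrD.
all: rewrite ler_norml ler_norml nE; apply/andP; split; apply/andP; split; lra.
Qed.

Section BestApproximations.
Variables (R : realType) (d : nat) (alpha : 'rV[R]_d) (N : nat -> nat).
Hypothesis best : best_approx_seq alpha N.

Lemma best_approx_gt0 i : (0 < i)%N -> (0 < N i)%N.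
Proof.
have [N1 Nstep] := best.
case: i => // -[_|i _]; first by rewrite N1.
by have [// /= lt_N _ _] := Nstep i.+2 isT; rewrite (leq_ltn_trans _ lt_N).
Qed.

(** Between consecutive terms the minimality of [N i] applies; smaller [M] are reached by induction
    along the decreasing brackets, starting from [N 1 = 1]. *)
Lemma best_approx_lt i M : (2 <= i)%N -> (0 < M < N i)%N ->
  bracket ((N i)%:R *: alpha) < bracket (M%:R *: alpha).
Proof.
have [N1 Nstep] := best.
elim: i M => [//|[//|i] IH] M _ /andP[M0 MN].
have [// _ lt_b min_b] := Nstep i.+2 isT; rewrite /= in lt_b min_b.
case: (ltngtP M (N i.+1)) => [ltM|gtM|->] //; last first.
  by apply: lt_le_trans lt_b _; rewrite leNgt; apply/negP; exact: min_b.
apply: lt_trans lt_b _; case: i IH ltM {Nstep min_b MN} => [_|i IH] ltM.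
  by move: ltM M0; rewrite N1; case: M.
by apply: IH => //; rewrite M0.
Qed.
End BestApproximations.

Lemma bracket_le (R : realType) (d : nat) (x : 'rV[R]_d.+1) (k : 'I_d.+1 -> int) (m : R) :
  (forall j, `|x 0 j - (k j)%:~R| <= m) -> bracket x <= m.
Proof.
move=> xm; apply/bigmax_leP; split=> [|j _]; first exact: le_trans (xm ord0).
exact: le_trans (dist_int_le _ _) (xm j).
Qed.

Section MinNorm.
Variables (R : realType) (d N : nat) (alpha : 'rV[R]_d.+1) (e : R).
Hypothesis N_gt0 : (0 < N)%N.
Hypothesis best : forall M, (0 < M < N)%N ->
  bracket (N%:R *: alpha) < bracket (M%:R *: alpha).
Hypothesis approx_ge : forall (n : nat) (k : 'I_d.+1 -> int), (0 < n < N)%N ->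
  exists j, e <= `|n%:R * alpha 0 j - (k j)%:~R|.
Let z j := nearest_int (N%:R * alpha 0 j).

(** Replacing [alpha] by [z / N] moves [n alpha] by at most [n / N <= 1 / 2] times the bracket of
    [N alpha], which is smaller than that of [n alpha]. So at least half of the largest deviation
    [mu j0] survives. *)
Lemma min_norm_half (n : nat) (k : 'I_d.+1 -> int) : (0 < n < N)%N -> (2 * n <= N)%N ->
  exists j, e / 2 <= `|n%:R * (z j)%:~R / N%:R - (k j)%:~R|.
Proof.
move=> nN n2; have NR : 0 < N%:R :> R by rewrite ltr0n.
pose mu j := `|n%:R * alpha 0 j - (k j)%:~R|.
pose j0 := [arg max_(j > ord0) mu j]%O.
have muj j : mu j <= mu j0 by rewrite /j0; case: arg_maxP => // i _; apply.
have e_mu : e <= mu j0 by have [j /le_trans] := approx_ge k nN; apply; exact: muj.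
have b_mu : bracket (n%:R *: alpha) <= mu j0.
  by apply: (@bracket_le _ _ _ k) => j; rewrite mxE muj.
exists j0; set a := n%:R * alpha 0 j0 - (k j0)%:~R.
set b := n%:R / N%:R * (N%:R * alpha 0 j0 - (z j0)%:~R).
have -> : n%:R * (z j0)%:~R / N%:R - (k j0)%:~R = a - b.
  by rewrite /a /b; field; rewrite gt_eqF.
have b_le : `|b| <= mu j0 / 2.
  rewrite /b normrM nearest_int_dist ger0_norm ?divr_ge0 ?ler0n // mulrC.
  have h : n%:R / N%:R <= 2^-1 :> R.
    by rewrite ler_pdivrMr // ler_pdivlMl // -natrM ler_nat.
  apply: ler_pM => //; rewrite ?divr_ge0 ?ler0n //.
    by rewrite -nearest_int_dist.
  apply: le_trans (ltW (lt_le_trans (best nN) b_mu)).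
  have -> : N%:R * alpha 0 j0 = (N%:R *: alpha) 0 j0 by rewrite mxE.
  exact: (@le_bigmax _ _ _ _ (fun j => dist_int ((N%:R *: alpha) 0 j))).
have : mu j0 <= `|a - b| + `|b|.
  by rewrite /mu -/a -[X in `|X| <= _](subrK b a) ler_normD.
lra.
Qed.

(** The lattice is symmetric and [N (z / N)] is integral, so a large [n] may be replaced by
    [N - n]. *)
Lemma min_norm_lattice (n : nat) (k : 'I_d.+1 -> int) : (0 < n < N)%N ->
  exists j, e / 2 <= `|n%:R * (z j)%:~R / N%:R - (k j)%:~R|.
Proof.
move=> nN; have [n2|n2] := leqP (2 * n) N; first exact: min_norm_half.
have NR : N%:R != 0 :> R by rewrite pnatr_eq0 -lt0n.
have /andP[n0 ltnN] := nN.
have nN' : (0 < N - n < N)%N by rewrite subn_gt0 ltnN ltn_subrL n0 N_gt0.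
have n2' : (2 * (N - n) <= N)%N by rewrite mulnBr leq_subLR mul2n -addnn leq_add2r ltnW.
have [j jP] := min_norm_half (fun j => z j - k j) nN' n2'; exists j.
apply: le_trans jP _; rewrite -normrN natrB 1?ltnW // intrB.
by rewrite le_eqVlt; apply/orP; left; apply/eqP; congr `|_|; field.
Qed.
End MinNorm.

Theorem mainTheorem7 (R : realType) (d : nat) (alpha : 'rV[R]_d)
  (N : nat -> nat) :
  (1 <= d)%N ->
  Q_lin_indep alpha ->
  qspan_is_field alpha ->
  best_approx_seq alpha N ->
  exists C : R, forall i : nat, (2 <= i)%N ->
    (@isotropic_discrepancy R d (N i)
       (fun j : 'I_d => nearest_int ((N i)%:R * alpha 0 j)%R)
     <= (C / ((N i)%:R `^ (d%:R)^-1))%:E)%E.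
Proof.
case: d alpha => // d alpha _ indep field_alpha best.
have [c0 c00 c0P] := badly_approximable indep field_alpha.
(* Capping at 1 ensures [e <= 1] below, as [badly_approximable] requires. *)
pose c := Num.min c0 1; have c_gt0 : 0 < c by rewrite lt_min c00 ltr01.
pose b := c `^ (d.+1%:R)^-1.
have rootK (x : R) : 0 <= x -> (x `^ (d.+1%:R)^-1) ^+ d.+1 = x.
  by move=> x0; rewrite -powR_mulrn ?powR_ge0 // -powRrM mulVf ?pnatr_eq0 // powRr1.
have b0 : 0 < b by rewrite powR_gt0.
have bD : b ^+ d.+1 = c by rewrite /b rootK // ltW.
have b1 : b <= 1 by rewrite -(@expr_le1 _ d.+1) ?(ltW b0) // bD ge_min lexx orbT.
have c2_gt0 : 0 < c / 2 ^+ d.+1 by rewrite divr_gt0 // exprn_gt0.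
have [a a1 aP] := pigeonhole_parameters d c2_gt0.
(* This is [3 * (cB * r)] for the covering radius [r = d.+1 * (a * lam)] and [lam = b / (2 t)], with
   the factor [1 / t] removed. *)
exists (3 * (boundary_constant R d * (d.+1%:R * (a * (b / 2))))) => i i2.
have N0 : (0 < N i)%N by apply: (best_approx_gt0 best); exact: ltnW.
have NR : 1 <= (N i)%:R :> R by rewrite ler1n.
set t := (N i)%:R `^ _; have tD : t ^+ d.+1 = (N i)%:R by rewrite /t rootK // ler0n.
have t0 : 0 < t by rewrite powR_gt0 // ltr0n.
have t1 : 1 <= t by rewrite -(@expr_ge1 _ d.+1) ?(ltW t0) // tD.
(* [e] solves [N e^(d+1) = c], so [n e^(d+1) < c <= c0] for [n < N], which contradicts bad
   approximability if all deviations are below [e]. *)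
pose e := b / t; have e0 : 0 < e by rewrite divr_gt0.
have e1 : e <= 1 by rewrite ler_pdivrMr // mul1r (le_trans b1).
have approx_ge (n : nat) (k : 'I_d.+1 -> int) : (0 < n < N i)%N ->
    exists j, e <= `|n%:R * alpha 0 j - (k j)%:~R|.
  move=> /andP[n0 nN]; apply: contrapT => /forallNP h.
  have := c0P n k e n0; rewrite (ltW e0) e1 => /(_ isT) H.
  have : c0 <= n%:R * e ^+ d.+1.
    by apply: H => j; rewrite leNgt; apply/negP => /ltW /h.
  apply/negP; rewrite -ltNge /e expr_div_n bD tD.
  apply: lt_le_trans (_ : c <= c0); last by rewrite ge_min lexx.
  by rewrite mulrCA gtr_pMr // ltr_pdivrMr ?ltr0n // mul1r ltr_nat.
have best_i M := @best_approx_lt _ _ _ _ best i M i2.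
pose z j := nearest_int ((N i)%:R * alpha 0 j).
have min_norm n k := @min_norm_lattice _ _ _ _ _ N0 best_i approx_ge n k.
pose lam := e / 2.
have lam01 : 0 < lam <= 1 by rewrite divr_gt0 //= /lam; lra.
have /andP[lam0 lam1] := lam01.
have params := aP (N i) lam lam01.
have cN : c / 2 ^+ d.+1 <= (N i)%:R * lam ^+ d.+1.
  rewrite /lam /e !expr_div_n bD tD mulrA [X in _ <= X / _]mulrC divfK //.
  by rewrite gt_eqF // ltr0n.
have lam_r : lam <= a * lam by rewrite ler_peMl // ltW.
have cover := @rank1_lattice_covering R d (N i) z N0 lam (a * lam) lam01 lam_r min_norm (params cN).
have a0 : 0 < a := lt_le_trans ltr01 a1.
have r0 : 0 < d.+1%:R * (a * lam) by rewrite mulr_gt0 ?ltr0n // mulr_gt0.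
apply: ge_ereal_sup => _ [C [Ccube Cconv] <-].
have := discrepancy_of_covering N0 r0 cover Ccube (convex_set_segment_closed Cconv).
congr (_ <= _%:E)%E; rewrite /lam /e; field; rewrite gt_eqF //.
Qed.
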